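(* Let $c\in(0,1)$, and let $e_4$, $I_c=[d_1(c),d_2(c)]$, $t_m(d)$, $t_M(d)$, $d_e(c)$ and the optimal parameter $d^*(c)$ be as defined in the context. (1) If $e_4(t_M(d_e(c)),d_e(c))\le |e_4(0,d_e(c))|$, then $d^*(c)=d_e(c)$. (2) If $e_4(t_M(d_e(c)),d_e(c))> |e_4(0,d_e(c))|$, then there exists a unique $d\in I_c$ with $d>d_e(c)$ such that $e_4(t_M(d),d)=|e_4(t_m(d),d)|$, and for this $d$ we have $d^*(c)=d$.
   Context: Here $c=\cos\varphi$ with $\varphi\in(0,\tfrac\pi2)$, and the unit circular arc $\alpha\mapsto(\cos\alpha,\sin\alpha)^T$, $\alpha\in[-\varphi,\varphi]$, is approximated by the quartic polynomial curve $p:[-1,1]\to\mathbb{R}^2$, $p(t)=\sum_{j=0}^4\binom4j\left(\tfrac{1+t}{2}\right)^j\left(\tfrac{1-t}{2}\right)^{4-j}b_j$, with control points $b_0=(c,-\sqrt{1-c^2})^T$, $b_1=b_0+d\,(1-c^2,c\sqrt{1-c^2})^T$, $b_2=\left(\frac{3-4d^2(1-c^2)}{3c},0\right)^T$, $b_3=b_4+d\,(1-c^2,-c\sqrt{1-c^2})^T$, $b_4=(c,\sqrt{1-c^2})^T$, where $d>0$ is a free parameter ($G^2$ interpolation at the endpoints of the arc). The signed curvature error $e_4(t,d)=1-\dfrac{p'(t)\times p''(t)}{\|p'(t)\|^3}$ is explicitly $$e_4(t,d)=1-\frac{2c^2\left(3(3-4d^2)(1-t^2)^2+8cd^3(1+3t^4)-6cd(1-t^2)\left(1-(5-4cd)t^2\right)\right)}{\sqrt{\left((1-c^2)t^2\left(4cdt^2+(3-4d^2)(1-t^2)\right)^2+c^2\left(2+(1-2cd)(1-3t^2)\right)^2\right)^3}}.$$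 The optimal parameter $d^*(c)$ is the parameter $d>0$ for which $\max_{t\in[-1,1]}|e_4(t,d)|$ is minimal (parameters $d$ for which the curvature is undefined at some $t\in[-1,1]$, i.e. $p'(t)=0$, are not admissible). $I_c=[d_1(c),d_2(c)]$, where $$d_1(c)=\tfrac{1}{192(c^3+2)}\Bigl(192\sqrt3-8(16+9\sqrt3)c+(144+37\sqrt3)c^2+3(592+232\sqrt2-533\sqrt3)c^3-(2608+1104\sqrt2-2415\sqrt3)c^4+(1104+408\sqrt2-973\sqrt3)c^5\Bigr),$$ $$d_2(c)=\tfrac{1}{120(c^3+2)}\Bigl(120\sqrt3-8(4+9\sqrt3)c+(144-11\sqrt3)c^2+(444+588\sqrt2-735\sqrt3)c^3-(652+996\sqrt2-1191\sqrt3)c^4+(276+408\sqrt2-493\sqrt3)c^5\Bigr).$$ For $d\in I_c$ the even function $e_4(\cdot,d)$ has a local minimum at $t=0$ and exactly two local extrema on $(0,1)$, one local maximum and one local minimum; $t_M(d)$ and $t_m(d)$ denote the points of $(0,1)$ at which $e_4(\cdot,d)$ has the local maximum and the local minimum, respectively. $d_e(c)$ denotes the unique $d\in I_c$ such that $e_4(0,d)=e_4(t_m(d),d)$. *)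

(* Defs.v *)
From Stdlib Require Import Reals Lra.
From Coquelicot Require Import Coquelicot.
Open Scope R_scope.

(* Control points.  Any index above 3 stands for [b_4]. *)
Definition control (c d : R) (j : nat) : R * R :=
  let s := sqrt (1 - c ^ 2) in
  match j with
  | 0%nat => (c, - s)
  | 1%nat => (c + d * (1 - c ^ 2), - s + d * (c * s))
  | 2%nat => ((3 - 4 * d ^ 2 * (1 - c ^ 2)) / (3 * c), 0)
  | 3%nat => (c + d * (1 - c ^ 2), s + d * (- (c * s)))
  | _ => (c, s)
  end.

(* [Binomial.C], since Coquelicot's [C] is the type of complex numbers. *)
Definition bernstein4 (b : nat -> R) (t : R) : R :=
  sum_f_R0 (fun j => Binomial.C 4 j * ((1 + t) / 2) ^ j
                       * ((1 - t) / 2) ^ (4 - j) * b j) 4.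

Definition p (c d t : R) : R * R :=
  (bernstein4 (fun j => fst (control c d j)) t,
   bernstein4 (fun j => snd (control c d j)) t).

Definition p' (c d t : R) : R * R :=
  (Derive (fun u => fst (p c d u)) t, Derive (fun u => snd (p c d u)) t).

Definition p'' (c d t : R) : R * R :=
  (Derive (fun u => fst (p' c d u)) t, Derive (fun u => snd (p' c d u)) t).

Definition cross (u v : R * R) : R := fst u * snd v - snd u * fst v.

Definition norm2 (u : R * R) : R := sqrt (fst u ^ 2 + snd u ^ 2).

Definition e4 (c t d : R) : R :=
  1 - cross (p' c d t) (p'' c d t) / norm2 (p' c d t) ^ 3.

Definition admissible (c d : R) : Prop :=
  forall t, -1 <= t <= 1 -> p' c d t <> (0, 0).

Definition is_max_error (c d M : R) : Prop :=
  (exists t, -1 <= t <= 1 /\ Rabs (e4 c t d) = M) /\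
  (forall t, -1 <= t <= 1 -> Rabs (e4 c t d) <= M).

(* [d = d^*(c)]: [d] is the one and only minimiser, hence the strict
   inequality.  For an admissible parameter the maximal error exists, because
   [e4 c _ d] is then continuous on [[-1, 1]]. *)
Definition is_optimal_parameter (c d : R) : Prop :=
  0 < d /\ admissible c d /\
  exists M, is_max_error c d M /\
    forall d' M', 0 < d' -> admissible c d' -> d' <> d ->
      is_max_error c d' M' -> M < M'.

Definition d1 (c : R) : R :=
  1 / (192 * (c ^ 3 + 2)) *
  (192 * sqrt 3 - 8 * (16 + 9 * sqrt 3) * c
   + (144 + 37 * sqrt 3) * c ^ 2
   + 3 * (592 + 232 * sqrt 2 - 533 * sqrt 3) * c ^ 3
   - (2608 + 1104 * sqrt 2 - 2415 * sqrt 3) * c ^ 4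
   + (1104 + 408 * sqrt 2 - 973 * sqrt 3) * c ^ 5).

Definition d2 (c : R) : R :=
  1 / (120 * (c ^ 3 + 2)) *
  (120 * sqrt 3 - 8 * (4 + 9 * sqrt 3) * c
   + (144 - 11 * sqrt 3) * c ^ 2
   + (444 + 588 * sqrt 2 - 735 * sqrt 3) * c ^ 3
   - (652 + 996 * sqrt 2 - 1191 * sqrt 3) * c ^ 4
   + (276 + 408 * sqrt 2 - 493 * sqrt 3) * c ^ 5).

Definition in_I (c d : R) : Prop := d1 c <= d <= d2 c.

Definition is_local_max (f : R -> R) (t : R) : Prop :=
  locally t (fun u => f u <= f t).

Definition is_local_min (f : R -> R) (t : R) : Prop :=
  locally t (fun u => f t <= f u).

Definition is_tM (c d t : R) : Prop :=
  unique (fun u => 0 < u < 1 /\ is_local_max (fun v => e4 c v d) u) t.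

Definition is_tm (c d t : R) : Prop :=
  unique (fun u => 0 < u < 1 /\ is_local_min (fun v => e4 c v d) u) t.

Definition is_de (c : R) (tm : R -> R) (de : R) : Prop :=
  unique (fun d => in_I c d /\ e4 c 0 d = e4 c (tm d) d) de.

(* The closed form of [e4], as a check on the definition. *)

Lemma bernstein4E b t :
  bernstein4 b t = ((1 - t) / 2) ^ 4 * b 0%nat
    + 4 * ((1 + t) / 2) * ((1 - t) / 2) ^ 3 * b 1%nat
    + 6 * ((1 + t) / 2) ^ 2 * ((1 - t) / 2) ^ 2 * b 2%nat
    + 4 * ((1 + t) / 2) ^ 3 * ((1 - t) / 2) * b 3%nat
    + ((1 + t) / 2) ^ 4 * b 4%nat.
Proof. unfold bernstein4, Binomial.C; simpl; field. Qed.

Lemma p'E c d t : c <> 0 ->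
  p' c d t =
  (- (1 - c ^ 2) / (2 * c) * t * (4 * c * d * t ^ 2 + (3 - 4 * d ^ 2) * (1 - t ^ 2)),
   sqrt (1 - c ^ 2) / 2 * (2 + (1 - 2 * c * d) * (1 - 3 * t ^ 2))).
Proof.
intros hc; unfold p'; apply f_equal2; apply is_derive_unique.
all: eapply is_derive_ext; [intros u; symmetry; apply bernstein4E|].
all: cbn [fst snd control]; set (s := sqrt (1 - c ^ 2)); auto_derive; [auto|].
all: field; auto.
Qed.

Lemma p''E c d t : c <> 0 ->
  p'' c d t =
  (- (1 - c ^ 2) / (2 * c)
     * (12 * c * d * t ^ 2 + (3 - 4 * d ^ 2) * (1 - 3 * t ^ 2)),
   sqrt (1 - c ^ 2) / 2 * (- 6 * (1 - 2 * c * d) * t)).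
Proof.
intros hc; unfold p''; apply f_equal2; apply is_derive_unique.
all: eapply is_derive_ext; [intros u; rewrite p'E by auto; reflexivity|].
all: cbn [fst snd]; set (s := sqrt (1 - c ^ 2)); auto_derive; [auto|].
all: field; auto.
Qed.

Lemma e4_explicit c t d : 0 < c < 1 ->
  e4 c t d =
  1 - 2 * c ^ 2 *
      (3 * (3 - 4 * d ^ 2) * (1 - t ^ 2) ^ 2 + 8 * c * d ^ 3 * (1 + 3 * t ^ 4)
       - 6 * c * d * (1 - t ^ 2) * (1 - (5 - 4 * c * d) * t ^ 2))
    / sqrt (((1 - c ^ 2) * t ^ 2
               * (4 * c * d * t ^ 2 + (3 - 4 * d ^ 2) * (1 - t ^ 2)) ^ 2
             + c ^ 2 * (2 + (1 - 2 * c * d) * (1 - 3 * t ^ 2)) ^ 2) ^ 3).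
Proof.
intros hc.
unfold e4, norm2, cross; rewrite p'E, p''E by lra; cbn [fst snd].
assert (h : 0 < 1 - c ^ 2) by nra.
set (A := 4 * c * d * t ^ 2 + _); set (B := 2 + _).
set (s := sqrt (1 - c ^ 2)).
assert (hs : 0 < s) by now apply sqrt_lt_R0.
assert (hs2 : 1 - c ^ 2 = s ^ 2) by (unfold s; rewrite pow2_sqrt; lra).
set (S := (1 - c ^ 2) * t ^ 2 * A ^ 2 + c ^ 2 * B ^ 2).
assert (hS : 0 <= S) by (unfold S; nra).
replace ((- (1 - c ^ 2) / (2 * c) * t * A) ^ 2 + (s / 2 * B) ^ 2)
  with ((s / (2 * c)) ^ 2 * S) by (unfold S; rewrite hs2; field; lra).
assert (hsc : 0 < s / (2 * c)) by (apply Rdiv_lt_0_compat; lra).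
rewrite sqrt_mult, sqrt_pow2 by nra.
rewrite <- (pow2_sqrt S hS) at 2.
assert (hr := sqrt_pos S); set (r := sqrt S) in *.
replace ((r ^ 2) ^ 3) with ((r ^ 3) ^ 2) by ring.
rewrite sqrt_pow2 by (apply pow_le; exact hr).
rewrite Rpow_mult_distr; unfold Rdiv; rewrite (Rinv_mult (_ ^ 3) (r ^ 3)).
set (q := / r ^ 3).
rewrite hs2; unfold A, B.
match goal with |- 1 - ?x * _ = 1 - ?y * _ =>
  assert (E : x * / (s * / (2 * c)) ^ 3 = y) end.
{ field; lra. }
rewrite <- E; ring.
Qed.

(* Main.v *)
(* The error at [t = 0] vanishes for a value of [d] which is rational in [s] once [c] is
   written [6 s ^ 2 - 2].  So the relevant parameters are written [dl s x], affine in [x],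
   and every inequality needed becomes the positivity of an integer polynomial on a box,
   which is read off its Bernstein coefficients.

   They show that the interval [I_c] lies in a range of [d] where the error decreases with
   [d] at each [t ^ 2 > 4 / 19] and increases with [d] at [t = 0], and outside of which the
   maximal error is at least [mu s].  On [I_c] the local maximum and minimum lie on the two
   sides of [t = sqrt (2 / 5)], both with [t ^ 2 > 4 / 19], so their values decrease with
   [d].  Balancing the minimum either against the value at [0] or against the maximum
   therefore gives a strict optimum: changing [d] worsens one of the two balanced values. *)

Require Import Defs.
From Stdlib Require Import Reals ZArith List Lra Lia.
From Coquelicot Require Import Coquelicot.
Import ListNotations.
Open Scope R_scope.

(** * Positivity of integer polynomials on boxes *)

(** The error at [t = 0] vanishes when a quadratic in [d] does. Its discriminant is
    [96 (1 - c) ^ 2 (c + 2)], and [c = 6 s ^ 2 - 2] turns the square root of this into a polynomial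
    in [s]. The obstacle is the flat limit [c = 1], where [1 - 2 s ^ 2 = (1 - c) / 3] vanishes: the
    errors to be compared there are of the order of its cube, so the inequalities degenerate at
    [s = sqrt (1 / 2)], an irrational point which a rational box covering the range of [s] must
    contain in its interior. A power of [1 - 2 s ^ 2] is therefore divided off exactly before
    positivity is tested, the thresholds [mu] and [beta] carry its cube, and the unit in which [x]
    measures [d] carries its square. At the other end [c = 0] the powers of [3 s ^ 2 - 1 = c / 2]
    are cancelled symbolically. Existence and uniqueness of the two interior extrema are given, so
    the sign of the [t]-derivative matters only at [t ^ 2 = 3 / 14], [2 / 5] and [1]; uniqueness
    excludes everything else. *)

Fixpoint mp (n : nat) : Type :=
  match n with O => Z | S k => list (mp k) end.

(** The outermost list holds the coefficients in the first variable. A valuation that is too short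
    is read as padded with [0], in agreement with [nth] in [eval]. *)
Fixpoint mev (n : nat) : mp n -> list R -> R :=
  match n with
  | O => fun z _ => IZR z
  | S k => fun p l =>
      fold_right (fun a r => mev k a (tl l) + hd 0 l * r) 0 p
  end.

Fixpoint mcst (n : nat) (z : Z) : mp n :=
  match n with O => z | S k => [mcst k z] end.

Fixpoint mvar (n i : nat) : mp n :=
  match n with
  | O => 0%Z
  | S k => match i with
           | O => [mcst k 0; mcst k 1]
           | S j => [mvar k j]
           end
  end.

Fixpoint padd {A : Type} (f : A -> A -> A) (p q : list A) : list A :=
  match p, q with
  | [], _ => q
  | _, [] => p
  | a :: p', b :: q' => f a b :: padd f p' q'
  end.

Fixpoint madd (n : nat) : mp n -> mp n -> mp n :=
  match n with O => Z.add | S k => padd (madd k) end.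

Fixpoint mscale (n : nat) (z : Z) : mp n -> mp n :=
  match n with O => Z.mul z | S k => map (mscale k z) end.

Definition pmul {A : Type} (add mul : A -> A -> A) (z : A) :=
  fix pm (p q : list A) : list A :=
    match p with
    | [] => []
    | a :: p' => padd add (map (mul a) q) (z :: pm p' q)
    end.

Fixpoint mmul (n : nat) : mp n -> mp n -> mp n :=
  match n with
  | O => Z.mul
  | S k => pmul (madd k) (mmul k) (mcst k 0)
  end.

Lemma mev_cst n z l : mev n (mcst n z) l = IZR z.
Proof.
revert l; induction n as [|n IH]; intros l; simpl; [reflexivity|].
rewrite IH; ring.
Qed.

Lemma mev_var n i l : (i < n)%nat -> mev n (mvar n i) l = nth i l 0.
Proof.
revert i l; induction n as [|n IH]; intros i l h; [lia|].
destruct i as [|i]; simpl.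
- rewrite !mev_cst; destruct l; simpl; ring.
- rewrite IH by lia; destruct l as [|x l]; simpl; [destruct i|]; ring.
Qed.

Lemma mev_add n p q l : mev n (madd n p q) l = mev n p l + mev n q l.
Proof.
revert p q l; induction n as [|n IH]; intros p q l; [apply plus_IZR|].
simpl; revert q; induction p as [|a p IHp]; intros [|b q]; simpl; try ring.
rewrite IH, IHp; ring.
Qed.

Lemma mev_scale n z p l : mev n (mscale n z p) l = IZR z * mev n p l.
Proof.
revert p l; induction n as [|n IH]; intros p l; [apply mult_IZR|].
simpl; induction p as [|a p IHp]; simpl; [ring|].
rewrite IH, IHp; ring.
Qed.

Lemma mev_mul n p q l : mev n (mmul n p q) l = mev n p l * mev n q l.
Proof.
revert p q l; induction n as [|n IH]; intros p q l; [apply mult_IZR|].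
induction p as [|a p IHp]; [simpl; ring|].
change (mmul (S n) (a :: p) q) with
  (madd (S n) (map (mmul n a) q) (mcst n 0 :: mmul (S n) p q)).
rewrite mev_add.
change (mev (S n) (mcst n 0 :: mmul (S n) p q) l) with
  (mev n (mcst n 0) (tl l) + hd 0 l * mev (S n) (mmul (S n) p q) l).
rewrite IHp, mev_cst.
assert (E : mev (S n) (map (mmul n a) q) l = mev n a (tl l) * mev (S n) q l).
{ clear IHp; simpl; induction q as [|b q IHq]; simpl; [ring|].
  rewrite IHq, IH; ring. }
rewrite E; simpl; ring.
Qed.

(** * Reified polynomial expressions *)

Inductive expr : Type :=
| ECst (z : Z) | EVar (i : nat)
| EAdd (a b : expr) | ESub (a b : expr) | EMul (a b : expr) | EPow (a : expr) (n : nat).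

Fixpoint eval (e : expr) (l : list R) : R :=
  match e with
  | ECst z => IZR z
  | EVar i => nth i l 0
  | EAdd a b => eval a l + eval b l
  | ESub a b => eval a l - eval b l
  | EMul a b => eval a l * eval b l
  | EPow a n => eval a l ^ n
  end.

Fixpoint mpow (n : nat) (p : mp n) (k : nat) : mp n :=
  match k with O => mcst n 1 | S j => mmul n p (mpow n p j) end.

Fixpoint norm (n : nat) (e : expr) : mp n :=
  match e with
  | ECst z => mcst n z
  | EVar i => mvar n i
  | EAdd a b => madd n (norm n a) (norm n b)
  | ESub a b => madd n (norm n a) (mscale n (-1) (norm n b))
  | EMul a b => mmul n (norm n a) (norm n b)
  | EPow a k => mpow n (norm n a) k
  end.

Lemma mev_norm n e l : length l = n -> mev n (norm n e) l = eval e l.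
Proof.
intros hl; induction e as [z|i|a IHa b IHb|a IHa b IHb|a IHa b IHb|a IHa k]; simpl.
- apply mev_cst.
- destruct (Nat.lt_ge_cases i n) as [h|h]; [now apply mev_var|].
  (* An index out of range gives the default [0] on one side and the zero polynomial of [mvar] on
     the other. *)
  rewrite nth_overflow by lia; clear hl; revert i l h.
  induction n as [|n IH]; intros i l h; [reflexivity|].
  destruct i as [|i]; [lia|]; simpl; rewrite IH by lia; ring.
- now rewrite mev_add, IHa, IHb.
- rewrite mev_add, mev_scale, IHa, IHb; ring.
- now rewrite mev_mul, IHa, IHb.
- rewrite <- IHa; induction k as [|k IHk]; simpl; [apply mev_cst|].
  now rewrite mev_mul, IHk.
Qed.

Fixpoint mzero (n : nat) : mp n -> bool :=
  match n with O => Z.eqb 0 | S k => forallb (mzero k) end.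

Lemma mzero_ok n p l : mzero n p = true -> mev n p l = 0.
Proof.
revert p l; induction n as [|n IH]; intros p l h.
- now rewrite <- (proj1 (Z.eqb_eq 0 p) h).
- simpl in *; induction p as [|a p IHp]; simpl in *; [reflexivity|].
  apply andb_prop in h as [h1 h2]; rewrite IH, IHp by assumption; ring.
Qed.

(** * Exact division in the first variable *)

Fixpoint mquo (n : nat) (z : Z) : mp n -> mp n :=
  match n with O => fun a => Z.div a z | S k => map (mquo k z) end.

Fixpoint sub_scaled (n : nat) (c : mp n) (f : list Z) (p : list (mp n)) :=
  match f, p with
  | z :: f', a :: p' => madd n a (mscale n (- z) c) :: sub_scaled n c f' p'
  | _, _ => p
  end.

(** Long division from the highest degree down: [z] is the leading coefficient of the divisor, [f]
    the rest of it, and [k] counts the quotient coefficients still to come. The accumulator [q]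
    comes out lowest degree first. *)
Fixpoint div_loop (n k : nat) (z : Z) (f : list Z) (p q : list (mp n)) :=
  match k, p with
  | S k', a :: p' =>
      let c := mquo n z a in div_loop n k' z f (sub_scaled n c f p') (c :: q)
  | _, _ => q
  end.

(* Quotient by a polynomial in the first variable; when the division is not
   exact the result is junk, so it is checked by multiplication afterwards. *)
Definition mdiv (n : nat) (p : mp (S n)) (f : list Z) : mp (S n) :=
  match rev f with
  | z :: f' => div_loop n (length p - length f') z f' (rev p) []
  | [] => []
  end.

Definition lift (n : nat) (f : list Z) : mp (S n) := map (mcst n) f.

Lemma mev_lift n f l : mev (S n) (lift n f) l = mev 1 f [hd 0 l].
Proof.
unfold lift; simpl; induction f as [|z f IH]; simpl; [reflexivity|].
now rewrite mev_cst, IH.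
Qed.

(** * Bernstein coefficients and positivity on a box *)

Definition box := (Z * Z * Z)%type.

(** A triple [(lo, hi, q)] is the open interval from [lo / q] to [hi / q]. Openness makes
    [(q x - lo) / (hi - q x)] finite and positive. *)
Fixpoint in_box (bs : list box) (l : list R) : Prop :=
  match bs, l with
  | [], [] => True
  | (lo, hi, q) :: bs', x :: l' =>
      0 < IZR q /\ IZR lo < IZR q * x < IZR hi /\ in_box bs' l'
  | _, _ => False
  end.

Fixpoint shift (n : nat) (z : Z) (p : mp (S n)) : mp (S n) :=
  match p with
  | [] => []
  | a :: p' => let r := shift n z p' in madd (S n) (a :: r) (mscale (S n) z r)
  end.

Fixpoint dilate (n : nat) (z s : Z) (p : mp (S n)) : mp (S n) :=
  match p with
  | [] => []
  | a :: p' => mscale n s a :: dilate n z (z * s) p'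
  end.

(** Rewrites a polynomial in [x] as one in [q x], multiplied by a power of [q] that keeps it
    integral. The integer returned is one power higher. *)
Fixpoint clear_den (n : nat) (q : Z) (p : mp (S n)) : mp (S n) * Z :=
  match p with
  | [] => ([], 1%Z)
  | a :: p' => let (r, s) := clear_den n q p' in (mscale n s a :: r, (q * s)%Z)
  end.

(* Numerator of a polynomial at [(lo + hi y) / (q (1 + y))]; its coefficients
   are positive multiples of the Bernstein coefficients on [(lo/q, hi/q)].
   Taylor shifts and reversals keep the integers small. *)
Definition bernstein (n : nat) (b : box) (p : mp (S n)) : mp (S n) :=
  let '(lo, hi, q) := b in
  rev (shift n 1 (rev (dilate n (hi - lo) 1 (shift n lo (fst (clear_den n q p)))))).

Lemma mev_cons n a (p : list (mp n)) x l :
  mev (S n) (a :: p) (x :: l) = mev n a l + x * mev (S n) p (x :: l).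
Proof. reflexivity. Qed.

Lemma mev_shift n z p x l :
  mev (S n) (shift n z p) (x :: l) = mev (S n) p ((x + IZR z) :: l).
Proof.
induction p as [|a p IH]; [reflexivity|].
cbn [shift]; rewrite mev_add, mev_scale, !mev_cons, IH; ring.
Qed.

Lemma mev_dilate n z s p x l :
  mev (S n) (dilate n z s p) (x :: l) = IZR s * mev (S n) p ((IZR z * x) :: l).
Proof.
revert s; induction p as [|a p IH]; intros s; [simpl; ring|].
cbn [dilate]; rewrite !mev_cons, IH, mev_scale, mult_IZR; ring.
Qed.

Lemma mev_snoc n (p : list (mp n)) a x l :
  mev (S n) (p ++ [a]) (x :: l) = mev (S n) p (x :: l) + x ^ length p * mev n a l.
Proof.
induction p as [|b p IH]; [simpl; ring|].
cbn [app]; rewrite !mev_cons, IH.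
change (length (b :: p)) with (S (length p)); cbn [pow]; ring.
Qed.

(** The factor [x] on the left allows the exponent [length p] in place of the degree, which covers
    the empty list. *)
Lemma mev_rev n (p : list (mp n)) x l : x <> 0 ->
  x * mev (S n) (rev p) (x :: l) = x ^ length p * mev (S n) p ((/ x) :: l).
Proof.
intros hx; induction p as [|a p IH]; [simpl; ring|].
cbn [rev]; rewrite mev_snoc, Rmult_plus_distr_l, IH, mev_cons, length_rev.
change (length (a :: p)) with (S (length p)); cbn [pow]; field; exact hx.
Qed.

Lemma mev_rev_pos n (p : mp (S n)) x l : 0 < x ->
  exists k, 0 < k /\ mev (S n) (rev p) (x :: l) = k * mev (S n) p ((/ x) :: l).
Proof.
intros hx; exists (x ^ length p / x); split.
- apply Rdiv_lt_0_compat; [now apply pow_lt|exact hx].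
- apply Rmult_eq_reg_l with x; [|lra].
  transitivity (x ^ length p * mev (S n) p (/ x :: l)).
  + now apply (mev_rev n p); lra.
  + field; lra.
Qed.

Lemma clear_den_ok n q p x l :
  let (r, s) := clear_den n q p in
  mev (S n) r ((IZR q * x) :: l) * IZR q = IZR s * mev (S n) p (x :: l) /\
  (0 < IZR q -> 0 < IZR s).
Proof.
induction p as [|a p IH]; [simpl; split; [ring|lra]|].
cbn [clear_den]; destruct (clear_den n q p) as [r s]; destruct IH as [IH1 IH2].
rewrite !mev_cons, mev_scale, mult_IZR; split.
- transitivity (IZR s * mev n a l * IZR q
    + IZR q * x * (mev (S n) r (IZR q * x :: l) * IZR q)); [ring|].
  rewrite IH1; ring.
- intros hq; apply Rmult_lt_0_compat; auto.
Qed.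

Lemma bernstein_ok n lo hi q p x l :
  0 < IZR q -> IZR lo < IZR q * x < IZR hi ->
  exists y k, 0 < y /\ 0 < k /\
    mev (S n) (bernstein n (lo, hi, q) p) (y :: l) = k * mev (S n) p (x :: l).
Proof.
intros hq hx.
(* The solution of [q x = (lo + hi y) / (1 + y)]. *)
set (y := (IZR q * x - IZR lo) / (IZR hi - IZR q * x)).
assert (hy : 0 < y) by (apply Rdiv_lt_0_compat; lra).
generalize (clear_den_ok n q p x l); unfold bernstein.
destruct (clear_den n q p) as [r s]; intros [E hs]; cbn [fst]; specialize (hs hq).
set (P := dilate n (hi - lo) 1 (shift n lo r)).
assert (hP : mev (S n) P ((y / (1 + y)) :: l) = IZR s / IZR q * mev (S n) p (x :: l)).
{ unfold P; rewrite mev_dilate, mev_shift, minus_IZR.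
  replace ((IZR hi - IZR lo) * (y / (1 + y)) + IZR lo) with (IZR q * x)
    by (unfold y; field; lra).
  apply Rmult_eq_reg_r with (IZR q); [|lra].
  rewrite Rmult_1_l, E; field; lra. }
destruct (mev_rev_pos n (shift n 1 (rev P)) y l hy) as [k1 [hk1 E1]].
assert (ht : 0 < / y + IZR 1) by (generalize (Rinv_0_lt_compat y hy); lra).
destruct (mev_rev_pos n P (/ y + IZR 1) l ht) as [k2 [hk2 E2]].
exists y, (k1 * (k2 * (IZR s / IZR q))); split; [exact hy|]; split.
{ repeat apply Rmult_lt_0_compat; auto; now apply Rinv_0_lt_compat. }
rewrite E1, mev_shift, E2.
replace (/ (/ y + IZR 1)) with (y / (1 + y)) by (field; lra).
rewrite hP; ring.
Qed.

Fixpoint nonnegb (n : nat) (bs : list box) : mp n -> bool :=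
  match n with
  | O => fun z => Z.leb 0 z
  | S k => fun p =>
      match bs with
      | b :: bs' => forallb (nonnegb k bs') (bernstein k b p)
      | [] => false
      end
  end.

(** As [y > 0], it is enough that the constant coefficient is strictly positive and the others
    nonnegative; the polynomial may still vanish at the upper end of the interval. *)
Fixpoint posb (n : nat) (bs : list box) : mp n -> bool :=
  match n with
  | O => fun z => Z.ltb 0 z
  | S k => fun p =>
      match bs with
      | b :: bs' =>
          match bernstein k b p with
          | a :: r => (posb k bs' a && forallb (nonnegb k bs') r)%bool
          | [] => false
          end
      | [] => false
      end
  end.

Lemma horner_nonneg (A : Type) (f : A -> R) (P : A -> bool) p y :
  (forall a, P a = true -> 0 <= f a) -> 0 <= y -> forallb P p = true ->
  0 <= fold_right (fun a r => f a + y * r) 0 p.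
Proof.
intros hP hy; induction p as [|a p IH]; simpl; intros h; [lra|].
apply andb_prop in h as [h1 h2].
generalize (hP a h1) (Rmult_le_pos _ _ hy (IH h2)); lra.
Qed.

Lemma nonneg_ok n bs p l :
  nonnegb n bs p = true -> in_box bs l -> 0 <= mev n p l.
Proof.
revert bs p l; induction n as [|n IH]; intros bs p l h hb.
- now apply IZR_le, Z.leb_le.
- destruct bs as [|[[lo hi] q] bs]; [discriminate|].
  destruct l as [|x l]; [contradiction|]; destruct hb as [hq [hx hb]].
  destruct (bernstein_ok n lo hi q p x l hq hx) as [y [k [hy [hk E]]]].
  apply Rmult_le_reg_l with k; [exact hk|]; rewrite <- E, Rmult_0_r.
  apply (horner_nonneg _ (fun a => mev n a l) (nonnegb n bs)); [|simpl; lra|exact h].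
  intros a ha; now apply (IH bs).
Qed.

Lemma pos_ok n bs p l : posb n bs p = true -> in_box bs l -> 0 < mev n p l.
Proof.
revert bs p l; induction n as [|n IH]; intros bs p l h hb.
- now apply IZR_lt, Z.ltb_lt.
- destruct bs as [|[[lo hi] q] bs]; [discriminate|].
  destruct l as [|x l]; [contradiction|]; destruct hb as [hq [hx hb]].
  destruct (bernstein_ok n lo hi q p x l hq hx) as [y [k [hy [hk E]]]].
  apply Rmult_lt_reg_l with k; [exact hk|]; rewrite <- E, Rmult_0_r.
  cbn [posb] in h; destruct (bernstein n (lo, hi, q) p) as [|a g]; [discriminate|].
  apply andb_prop in h as [h1 h2]; rewrite mev_cons.
  apply Rplus_lt_le_0_compat; [now apply (IH bs)|].
  apply Rmult_le_pos; [lra|].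
  apply (horner_nonneg _ (fun a => mev n a l) (nonnegb n bs)); [|simpl; lra|exact h2].
  intros b hb'; now apply (nonneg_ok n bs).
Qed.

(** Only the quotient has to be positive on the whole box. The factor [f] may change sign there; its
    sign is asked for at the actual point. *)
Definition pos_quot (n : nat) (f : list Z) (bs : list box) (p : mp (S n)) : bool :=
  let q := mdiv n p f in
  (mzero (S n) (madd (S n) p (mscale (S n) (-1) (mmul (S n) (lift n f) q))) &&
   posb (S n) bs q)%bool.

Lemma pos_quot_ok n f bs p x l :
  pos_quot n f bs p = true -> in_box bs (x :: l) -> 0 < mev 1 f [x] ->
  0 < mev (S n) p (x :: l).
Proof.
unfold pos_quot; set (q := mdiv n p f); intros h hb hf.
apply andb_prop in h as [h1 h2].
apply (mzero_ok _ _ (x :: l)) in h1.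
rewrite mev_add, mev_scale, mev_mul, mev_lift in h1; simpl hd in h1.
assert (hq := pos_ok _ _ _ _ h2 hb).
assert (0 < mev 1 f [x] * mev (S n) q (x :: l)) by now apply Rmult_lt_0_compat.
lra.
Qed.

Definition check (n : nat) (f e : expr) (bs : list box) : bool :=
  pos_quot n (norm 1 f) bs (norm (S n) e).

Lemma check_ok n f e bs x l :
  check n f e bs = true -> length l = n -> in_box bs (x :: l) ->
  0 < eval f [x] -> 0 < eval e (x :: l).
Proof.
intros h hl hb hf; rewrite <- (mev_norm (S n)) by (simpl; lia).
apply pos_quot_ok with (norm 1 f) bs; auto.
now rewrite mev_norm.
Qed.

(** * Certificates *)

Declare Scope expr_scope.
Delimit Scope expr_scope with expr.
Bind Scope expr_scope with expr.
Notation "a + b" := (EAdd a b) : expr_scope.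
Notation "a - b" := (ESub a b) : expr_scope.
Notation "a * b" := (EMul a b) : expr_scope.
Notation "a ^ n" := (EPow a n%nat) : expr_scope.
Notation "# z" := (ECst z%Z) (at level 1, format "# z") : expr_scope.

(* Numerators with [c = K C], [d = n / (2 m)] and [t ^ 2 = u / v], where
   [3 m ^ 2 - n ^ 2 = C R]; all powers of [C] have been cancelled. *)
Section Forms.
Local Open Scope expr_scope.
Variables K C R n m u v : expr.

Definition xA := #2 * K * n * m * u + R * (v - u).
Definition xB := #3 * m * (v - u) - K * C * n * (v - #3 * u).
Definition xS := (#1 - (K * C)^2) * u * xA^2 + (K * xB * m)^2 * v.
Definition xN :=
  #3 * R * m * (v - u)^2 + K * n^3 * (v^2 + #3 * u^2)
  - #3 * K * n * m * (v - u) * (m * v - (#5 * m - #2 * K * C * n) * u).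

Definition xSd :=
  #2 * (#1 - (K * C)^2) * u * xA * (K * C * u * m - n * (v - u))
  - K^3 * C^2 * xB * m^2 * v * (v - #3 * u).
Definition xNd :=
  K * C * n^2 * (v^2 + #3 * u^2) - #2 * n * m * (v - u)^2
  - K * C * m * (v - u) * (m * (v - #5 * u) + #4 * K * C * n * u).

Definition xSu :=
  (#1 - (K * C)^2) * (xA^2 + #2 * u * xA * (#2 * K * n * m - R))
  - #6 * K^2 * xB * (m - K * C * n) * m^2 * v.
Definition xNu :=
  #6 * K * n^3 * u - #6 * R * m * (v - u)
  + #3 * K * n * m * (m * v - (#5 * m - #2 * K * C * n) * u
                      + (v - u) * (#5 * m - #2 * K * C * n)).

Definition xDd := xNd * xS - xN * xSd.
Definition xDu := #3 * xN * xSu - #2 * xNu * xS.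
(** Its sign compares the square of the curvature with [(b / a) ^ 2], which avoids the square root
    in the denominator. *)
Definition xK (a b : expr) := #4 * K^4 * m^6 * v^5 * (xN * a)^2 - b^2 * xS^3.
Definition xQ (a b : expr) := K * a * (#3 * m - K * C * n)^2 - #2 * b * R.
End Forms.

Section Family.
Local Open Scope expr_scope.
Definition xs := EVar 0.
(** In terms of [c], [xC] is [c / 2], [xE] is [(1 - c) / 3], and [xD] is a factor of [c ^ 3 + 2]. *)
Definition xC (s : expr) := #3 * s^2 - #1.
Definition xE (s : expr) := #1 - #2 * s^2.
Definition xD (s : expr) := #6 * s^3 + #6 * s^2 - #1.
Definition xE3 := (xE xs)^3.
Variables a b : expr.
(** [xn / (2 xm)] is [dl s (a / b)]. Giving [x] as a quotient of two expressions keeps fractions,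
    also those depending on [s], out of the polynomials. *)
Definition xn := b * (#3 * xs + #2) * (#2 * xs - #1) - a * xC xs * (xE xs)^2.
Definition xm := b * (#2 * xs - #1) * xD xs.
Definition xR :=
  (b * (#2 * xs - #1) * (#6 * xs^2 + #6 * xs + #1))^2
  + #2 * a * b * (#3 * xs + #2) * (#2 * xs - #1) * (xE xs)^2
  - a^2 * xC xs * (xE xs)^4.
Definition famN := xN #2 (xC xs) xR xn xm.
Definition famDd := xDd #2 (xC xs) xR xn xm.
Definition famDu := xDu #2 (xC xs) xR xn xm.
Definition famK := xK #2 (xC xs) xR xn xm.
Definition famQ := xQ #2 (xC xs) xR xn xm.
End Family.

(** A rational enclosure of the interval from [sqrt (1 / 3)] to [sqrt (1 / 2)]. *)
Definition box_s : box := (4, 5, 7)%Z.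
Definition box_x : box := (-1, 1, 3)%Z.

Local Open Scope expr_scope.

Lemma check_n : check 1 #1 (xn (EVar 1) #1) [box_s; box_x] = true.
Proof. vm_cast_no_check (eq_refl true). Qed.

Lemma check_mid :
  check 1 (xE xs) (xn (EVar 1) #1 - #2 * xC xs * xm #1) [box_s; box_x] = true.
Proof. vm_cast_no_check (eq_refl true). Qed.

Lemma check_cusp :
  check 1 #1 (#3 * xm #1 - #2 * xC xs * xn (EVar 1) #1) [box_s; box_x] = true.
Proof. vm_cast_no_check (eq_refl true). Qed.

Lemma check_N : check 2 #1 (famN (EVar 1) #1 (EVar 2) #1) [box_s; box_x; (0, 1, 1)%Z] = true.
Proof. vm_cast_no_check (eq_refl true). Qed.

Lemma check_Dd :
  check 2 (xE xs) (famDd (EVar 1) #1 (EVar 2) #1) [box_s; box_x; (4, 19, 19)%Z] = true.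
Proof. vm_cast_no_check (eq_refl true). Qed.

(** The variable [86 x - 9 + 10 s] turns the slanted lower bound for [x] into the side [0] of a
    box. *)
Lemma check_Du_3_14 :
  check 1 xE3 (famDu (#9 - #10 * xs + EVar 1) #86 #3 #14) [box_s; (0, 20, 1)%Z] = true.
Proof. vm_cast_no_check (eq_refl true). Qed.

Lemma check_Du_2_5 : check 1 xE3 (#0 - famDu (EVar 1) #1 #2 #5) [box_s; (0, 1, 8)%Z] = true.
Proof. vm_cast_no_check (eq_refl true). Qed.

Lemma check_Du_1 : check 1 xE3 (famDu (EVar 1) #1 #1 #1) [box_s; (0, 1, 8)%Z] = true.
Proof. vm_cast_no_check (eq_refl true). Qed.

Lemma check_gap0_third : check 0 xE3 (#0 - famQ #1 #3 (#2 + xE3) #2) [box_s] = true.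
Proof. vm_cast_no_check (eq_refl true). Qed.

Lemma check_gap0_neg_third : check 0 xE3 (famQ (#(-1)) #3 (#2 - xE3) #2) [box_s] = true.
Proof. vm_cast_no_check (eq_refl true). Qed.

Lemma check_gap0_9 : check 0 xE3 (famQ #1 #9 (#2 + xE3) #2) [box_s] = true.
Proof. vm_cast_no_check (eq_refl true). Qed.

Lemma check_kap_9 :
  check 1 xE3 (famK #1 #9 (EVar 1) #1 #2 (#2 - xE3)) [box_s; (0, 1, 2)%Z] = true.
Proof. vm_cast_no_check (eq_refl true). Qed.

Definition xbeta := (#11 - #12 * xs) * xE3.

Lemma check_kap_23 :
  check 1 xE3 (famK #1 #23 (EVar 1) #1 #22 (#22 - xbeta)) [box_s; (1, 2, 5)%Z] = true.
Proof. vm_cast_no_check (eq_refl true). Qed.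

Lemma check_kap_23_4_5 : check 0 xE3 (famK #1 #23 #4 #5 #22 (#22 + xbeta)) [box_s] = true.
Proof. vm_cast_no_check (eq_refl true). Qed.

Definition xL (s : expr) := #6 * s^3 + #3 * s^2 - #3 * s - #1.
Definition xc (s : expr) := #6 * s^2 - #2.

Lemma check_gap0_dL :
  check 0 xE3 (#0 - xQ (xc xs) #1 (#3 - (#2 * xL xs)^2) (#2 * xL xs) #1 (#2 + xE3) #2) [box_s]
  = true.
Proof. vm_cast_no_check (eq_refl true). Qed.

(** With [m = 1] this encodes [d = (1 - z) dL]. Here [z] comes before [s], so that the outermost
    coefficients are those of the expansion in [z] at the degenerate corner. *)
Definition xnlow := (#1 - EVar 0) * #2 * xL (EVar 1).
Definition xlow := xK (xc (EVar 1)) #1 (#3 - xnlow^2) xnlow #1 #4 #5 #2 (#2 + (xE (EVar 1))^3).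

Lemma check_lowN :
  check 1 #1 (xN (xc (EVar 1)) #1 (#3 - xnlow^2) xnlow #1 #4 #5)
    [(0, 1, 1)%Z; (9, 10, 14)%Z] = true.
Proof. vm_cast_no_check (eq_refl true). Qed.

(* In the variables [1 - d / dL] and [s], the polynomial [xlow] vanishes at the
   corner [(0, sqrt (1/2))]; its first two coefficients in the first variable are
   divisible by [E ^ 3] and [E]. *)
Definition low_check : bool :=
  let p := norm 2 xlow in
  (posb 2 [(0, 1, 1); (11, 12, 17)]%Z p && posb 2 [(1, 4, 4); (40, 41, 57)]%Z p &&
   match p with
   | p0 :: p1 :: r =>
       pos_quot 0 (norm 1 xE3) [(40, 41, 57)%Z] p0 &&
       pos_quot 0 (norm 1 (xE xs)) [(40, 41, 57)%Z] p1 &&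
       posb 2 [(0, 1, 3); (40, 41, 57)]%Z r
   | _ => false
   end)%bool.

Lemma low_checkE : low_check = true.
Proof. vm_cast_no_check (eq_refl true). Qed.
Local Close Scope expr_scope.

Lemma xlow_pos z s :
  0 < z < 1 -> 11 / 17 < s -> 0 < eval (xE xs) [s] -> 0 < eval xlow [z; s].
Proof.
intros hz hs hE.
assert (hE3 : 0 < eval xE3 [s]) by now apply (pow_lt (eval (xE xs) [s]) 3).
assert (hs' : s < 71 / 100) by (cbn in hE; nra).
rewrite <- (mev_norm 2) by reflexivity.
generalize low_checkE; unfold low_check; cbv zeta; generalize (norm 2 xlow); intros p h.
apply andb_prop in h as [h h3]; apply andb_prop in h as [h1 h2].
destruct p as [|p0 [|p1 r]]; [discriminate..|].
apply andb_prop in h3 as [h3 hr]; apply andb_prop in h3 as [hp0 hp1].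
destruct (Rlt_le_dec s (12 / 17)) as [h12|h12].
{ apply (pos_ok _ _ _ _ h1); cbn; repeat split; lra. }
destruct (Rlt_le_dec (1 / 4) z) as [h4|h4].
{ apply (pos_ok _ _ _ _ h2); cbn; repeat split; lra. }
assert (hw : in_box [(40, 41, 57)%Z] [s]) by (cbn; repeat split; lra).
assert (H0 := pos_quot_ok _ _ _ _ _ _ hp0 hw); rewrite mev_norm in H0 by reflexivity.
assert (H1 := pos_quot_ok _ _ _ _ _ _ hp1 hw); rewrite mev_norm in H1 by reflexivity.
assert (H2 : 0 < mev 2 r [z; s])
  by (apply (pos_ok _ _ _ _ hr); cbn; repeat split; lra).
rewrite !mev_cons.
apply Rplus_lt_le_0_compat; [auto|].
apply Rmult_le_pos; [lra|].
apply Rplus_le_le_0_compat; [now apply Rlt_le, H1|].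
apply Rmult_le_pos; [lra|now apply Rlt_le].
Qed.

(* [EVar 1] and [EVar 2] stand for [sqrt 2] and [sqrt 3]. *)
Section Endpoints.
Local Open Scope expr_scope.
Variables (L : Z) (r0 r1 r2 a b : expr).
Definition xends :=
  let q := (#3 * xs + EVar 2) * (#2 * xs + EVar 1) in
  #18 * (q * (r0 + r1 * xc xs + r2 * (xc xs)^2) - ECst L * (#3 * EVar 1 - #2 * EVar 2))
      * (#2 * xs - #1) * xD xs * b
  + a * ECst L * q * ((xc xs)^3 + #2).
End Endpoints.

Definition lin (a b c : Z) : expr := (ECst a + ECst b * EVar 1 + ECst c * EVar 2)%expr.
Definition xd1 := xends 96 (lin (-128) (-288) 312) (lin (-400) (-288) 469) (lin 1104 408 (-973)).
Definition xd2 := xends 60 (lin (-32) (-180) 168) (lin (-100) (-180) 205) (lin 276 408 (-493)).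
(** The radicals become independent variables in tiny boxes: their defining equations have already
    served to extract the vanishing factors in [endpoint_sub]. *)
Definition box_sqrt2 : box := (141421, 141422, 100000)%Z.
Definition box_sqrt3 : box := (173205, 173206, 100000)%Z.
Local Open Scope expr_scope.

Lemma check_d1 : check 2 #1 (xd1 #1 #9) [(577, 708, 1000)%Z; box_sqrt2; box_sqrt3] = true.
Proof. vm_cast_no_check (eq_refl true). Qed.

Lemma check_d2_lower1 : check 2 #1 (xd2 #1 #23) [(577, 650, 1000)%Z; box_sqrt2; box_sqrt3] = true.
Proof. vm_cast_no_check (eq_refl true). Qed.

Lemma check_d2_lower2 : check 2 #1 (xd2 #1 #23) [(6400, 7072, 10000)%Z; box_sqrt2; box_sqrt3] = true.
Proof. vm_cast_no_check (eq_refl true). Qed.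

Lemma check_d2_upper1 :
  check 2 #1 (#0 - xd2 (#9 - #10 * xs) #86) [(577, 650, 1000)%Z; box_sqrt2; box_sqrt3] = true.
Proof. vm_cast_no_check (eq_refl true). Qed.

Lemma check_d2_upper2 :
  check 2 #1 (#0 - xd2 (#9 - #10 * xs) #86) [(640, 708, 1000)%Z; box_sqrt2; box_sqrt3] = true.
Proof. vm_cast_no_check (eq_refl true). Qed.
Local Close Scope expr_scope.

(** * The curvature and its partial derivatives *)

(** Here [u] is [t ^ 2]. Up to factors depending on [c] only, [t] times [Af] and [Bf] are the
    components of [p'], and [Sf] is the squared speed. *)
Definition Af (c u d : R) := 4 * c * d * u + (3 - 4 * d ^ 2) * (1 - u).
Definition Bf (c u d : R) := 2 + (1 - 2 * c * d) * (1 - 3 * u).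
Definition Sf (c u d : R) := (1 - c ^ 2) * u * Af c u d ^ 2 + c ^ 2 * Bf c u d ^ 2.
Definition Nf (c u d : R) :=
  2 * c ^ 2 * (3 * (3 - 4 * d ^ 2) * (1 - u) ^ 2 + 8 * c * d ^ 3 * (1 + 3 * u ^ 2)
               - 6 * c * d * (1 - u) * (1 - (5 - 4 * c * d) * u)).
Definition kap (c u d : R) := Nf c u d / sqrt (Sf c u d ^ 3).

Definition Sd (c u d : R) :=
  2 * (1 - c ^ 2) * u * Af c u d * (4 * c * u - 8 * d * (1 - u))
  - 4 * c ^ 3 * Bf c u d * (1 - 3 * u).
Definition Nd (c u d : R) :=
  2 * c ^ 2 * (24 * c * d ^ 2 * (1 + 3 * u ^ 2) - 24 * d * (1 - u) ^ 2
               - 6 * c * (1 - u) * (1 - (5 - 8 * c * d) * u)).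
Definition Su (c u d : R) :=
  (1 - c ^ 2) * (Af c u d ^ 2 + 2 * u * Af c u d * (4 * c * d - (3 - 4 * d ^ 2)))
  - 6 * c ^ 2 * Bf c u d * (1 - 2 * c * d).
Definition Nu (c u d : R) :=
  2 * c ^ 2 * (48 * c * d ^ 3 * u - 6 * (3 - 4 * d ^ 2) * (1 - u)
               + 6 * c * d * (1 - (5 - 4 * c * d) * u + (1 - u) * (5 - 4 * c * d))).
(** [Dd] has the sign of the derivative of the curvature in [d]; [Du], with its terms in the
    opposite order, has for [t > 0] the sign of the derivative of the error in [t]. *)
Definition Dd (c u d : R) := 2 * Nd c u d * Sf c u d - 3 * Nf c u d * Sd c u d.
Definition Du (c u d : R) := 3 * Nf c u d * Su c u d - 2 * Nu c u d * Sf c u d.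

Lemma e4E c t d : 0 < c < 1 -> e4 c t d = 1 - kap c (t ^ 2) d.
Proof.
intros hc; rewrite e4_explicit by exact hc; unfold kap.
apply f_equal; unfold Rdiv; apply f_equal2; [unfold Nf; ring|].
apply f_equal, f_equal; apply (f_equal (fun x => x ^ 3)); unfold Sf, Af, Bf; ring.
Qed.

Lemma is_derive_div_sqrt3 (N S : R -> R) (x N' S' : R) :
  0 < S x -> is_derive N x N' -> is_derive S x S' ->
  is_derive (fun y => N y / sqrt (S y ^ 3)) x
    ((2 * N' * S x - 3 * N x * S') / (2 * S x * sqrt (S x ^ 3))).
Proof.
intros hS HN HS; assert (hS3 : 0 < S x ^ 3) by now apply pow_lt.
assert (hr := sqrt_lt_R0 _ hS3).
assert (e : sqrt (S x ^ 3) * sqrt (S x ^ 3) = S x ^ 3) by (apply sqrt_sqrt; lra).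
evar_last.
- apply is_derive_div; [exact HN| |lra].
  apply (is_derive_comp sqrt (fun y => S y ^ 3)).
  + apply is_derive_Reals, derivable_pt_lim_sqrt; exact hS3.
  + apply (is_derive_pow _ 3); exact HS.
- set (r := sqrt (S x ^ 3)) in *; set (s := S x) in *; set (n := N x).
  simpl (pred 3); change (INR 3) with (2 + 1).
  change scal with Rmult; simpl (mult _ _).
  transitivity ((N' * (r * r) - n * (3 * S' * s ^ 2 / 2)) / (r * (r * r))).
  + field; lra.
  + rewrite e; field; split; lra.
Qed.

Lemma kap_derive_d c u d : 0 < Sf c u d ->
  is_derive (fun x => kap c u x) d
    (Dd c u d / (2 * Sf c u d * sqrt (Sf c u d ^ 3))).
Proof.
intros hS; apply (is_derive_div_sqrt3 (fun x => Nf c u x) (fun x => Sf c u x)).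
- exact hS.
- unfold Nf, Nd; auto_derive; [auto|]; ring.
- unfold Sf, Sd, Af, Bf; auto_derive; [auto|]; ring.
Qed.

Lemma e4_derive_t c t d : 0 < c < 1 -> 0 < Sf c (t ^ 2) d ->
  is_derive (fun x => e4 c x d) t
    (t * Du c (t ^ 2) d / (Sf c (t ^ 2) d * sqrt (Sf c (t ^ 2) d ^ 3))).
Proof.
intros hc hS; assert (hr : 0 < sqrt (Sf c (t ^ 2) d ^ 3)) by now apply sqrt_lt_R0, pow_lt.
apply is_derive_ext with (fun x => 1 - Nf c (x ^ 2) d / sqrt (Sf c (x ^ 2) d ^ 3)).
{ intros x; symmetry; now apply e4E. }
evar_last.
- apply @is_derive_minus; [apply is_derive_const|].
  apply (is_derive_div_sqrt3 (fun x => Nf c (x ^ 2) d) (fun x => Sf c (x ^ 2) d)).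
  + exact hS.
  + instantiate (1 := 2 * t * Nu c (t ^ 2) d).
    unfold Nf, Nu; auto_derive; [auto|]; ring.
  + instantiate (1 := 2 * t * Su c (t ^ 2) d).
    unfold Sf, Su, Af, Bf; auto_derive; [auto|]; ring.
- set (r := sqrt _) in *; set (S := Sf c (t ^ 2) d) in *.
  unfold minus, plus, opp, zero, Du; cbn -[pow]; fold S; field; split; lra.
Qed.

Section Evaluation.
Variables (K C R' n m u v : expr) (l : list R).
Let c' := eval K l * eval C l.
Let d' := eval n l / (2 * eval m l).
Let u' := eval u l / eval v l.
Hypothesis (hm : eval m l <> 0) (hv : eval v l <> 0).
Hypothesis hR : 3 * eval m l ^ 2 - eval n l ^ 2 = eval C l * eval R' l.

Let Q : 3 - 4 * d' ^ 2 = eval C l * eval R' l / eval m l ^ 2.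
Proof. unfold d'; rewrite <- hR; field; exact hm. Qed.

Ltac clear_denominators :=
  rewrite ?Q; cbn [eval]; unfold c', d', u'; field; auto.

Let eval_xA : Af c' u' d' = eval C l * eval (xA K R' n m u v) l / (eval m l ^ 2 * eval v l).
Proof. unfold Af, xA; clear_denominators. Qed.

Let eval_xB : Bf c' u' d' = eval (xB K C n m u v) l / (eval m l * eval v l).
Proof. unfold Bf, xB; clear_denominators. Qed.

Lemma eval_xS :
  Sf c' u' d' = eval C l ^ 2 * eval (xS K C R' n m u v) l / (eval m l ^ 4 * eval v l ^ 3).
Proof.
unfold Sf; rewrite eval_xA, eval_xB; unfold xS; cbn [eval].
generalize (eval (xA K R' n m u v) l) (eval (xB K C n m u v) l); intros A B.
unfold c', u'; field; auto.
Qed.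

Lemma eval_xN :
  Nf c' u' d' = 2 * eval K l ^ 2 * eval C l ^ 3 * eval (xN K C R' n m u v) l
                / (eval m l ^ 3 * eval v l ^ 2).
Proof. unfold Nf, xN; clear_denominators. Qed.

Lemma eval_xDd :
  Dd c' u' d' = 24 * eval K l ^ 2 * eval C l ^ 4 * eval (xDd K C R' n m u v) l
                / (eval m l ^ 6 * eval v l ^ 5).
Proof.
assert (E1 : Nd c' u' d' = 12 * eval K l ^ 2 * eval C l ^ 2 * eval (xNd K C n m u v) l
                           / (eval m l ^ 2 * eval v l ^ 2))
  by (unfold Nd, xNd; clear_denominators).
assert (E2 : Sd c' u' d' = 4 * eval C l * eval (xSd K C R' n m u v) l
                           / (eval m l ^ 3 * eval v l ^ 3)).
{ unfold Sd; rewrite eval_xA, eval_xB; unfold xSd; cbn [eval].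
  generalize (eval (xA K R' n m u v) l) (eval (xB K C n m u v) l); intros A B.
  unfold c', d', u'; field; auto. }
unfold Dd; rewrite E1, E2, eval_xS, eval_xN; unfold xDd; cbn [eval].
generalize (eval (xNd K C n m u v) l) (eval (xSd K C R' n m u v) l)
  (eval (xN K C R' n m u v) l) (eval (xS K C R' n m u v) l); intros a b e f.
field; auto.
Qed.

Lemma eval_xDu :
  Du c' u' d' = 2 * eval K l ^ 2 * eval C l ^ 5 * eval (xDu K C R' n m u v) l
                / (eval m l ^ 7 * eval v l ^ 4).
Proof.
assert (E1 : Nu c' u' d' = 2 * eval K l ^ 2 * eval C l ^ 3 * eval (xNu K C R' n m u v) l
                           / (eval m l ^ 3 * eval v l))
  by (unfold Nu, xNu; clear_denominators).
assert (E2 : Su c' u' d' = eval C l ^ 2 * eval (xSu K C R' n m u v) l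
                           / (eval m l ^ 4 * eval v l ^ 2)).
{ unfold Su; rewrite eval_xA, eval_xB, Q; unfold xSu; cbn [eval].
  generalize (eval (xA K R' n m u v) l) (eval (xB K C n m u v) l); intros A B.
  unfold c', d', u'; field; auto. }
unfold Du; rewrite E1, E2, eval_xS, eval_xN; unfold xDu; cbn [eval].
generalize (eval (xNu K C R' n m u v) l) (eval (xSu K C R' n m u v) l)
  (eval (xN K C R' n m u v) l) (eval (xS K C R' n m u v) l); intros a b e f.
field; auto.
Qed.

Lemma eval_xK a b :
  (Nf c' u' d' * eval a l) ^ 2 - eval b l ^ 2 * Sf c' u' d' ^ 3 =
  eval C l ^ 6 * eval (xK K C R' n m u v a b) l / (eval m l ^ 12 * eval v l ^ 9).
Proof.
rewrite eval_xS, eval_xN; unfold xK; cbn [eval].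
generalize (eval (xN K C R' n m u v) l) (eval (xS K C R' n m u v) l); intros e f.
field; auto.
Qed.

Lemma eval_xQ a b :
  c' * eval a l * (3 - 2 * c' * d') ^ 2 - 2 * eval b l * (3 - 4 * d' ^ 2) =
  eval C l * eval (xQ K C R' n m a b) l / eval m l ^ 2.
Proof. unfold xQ; clear_denominators. Qed.
End Evaluation.

(** * Curvature estimates along the parametrization [dl] *)

(* The error at [t = 0] vanishes for [c = cs s], [d = dl s 0]; the ends of [I_c] are
   compared with [dl s x] for [x = 1 / 9], [1 / 23] and [(9 - 10 * s) / 86]. *)
Definition cs (s : R) := 2 * (3 * s ^ 2 - 1).
Definition dl (s x : R) :=
  ((3 * s + 2) * (2 * s - 1) - x * (3 * s ^ 2 - 1) * (1 - 2 * s ^ 2) ^ 2)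
  / (2 * ((2 * s - 1) * (6 * s ^ 3 + 6 * s ^ 2 - 1))).
(* For [d < dL s] the curvature at [t ^ 2 = 4 / 5] exceeds [1 + mu s]. *)
Definition dL (s : R) := 6 * s ^ 3 + 3 * s ^ 2 - 3 * s - 1.
(* Lower bound for the maximal error when [d] is not between [dl s (1 / 3)] and
   [dl s (- 1 / 3)]. *)
Definition mu (s : R) := (1 - 2 * s ^ 2) ^ 3 / 2.
(* At [d = dl s (1 / 23)] the local maximum of the error is below [beta s] and the local
   minimum is below [- beta s]. *)
Definition beta (s : R) := (11 - 12 * s) * (1 - 2 * s ^ 2) ^ 3 / 22.

Section Fixed_s.
Variable s : R.
Hypothesis hs : 0 < s /\ 1 / 3 < s ^ 2 < 1 / 2.

Lemma s_bounds : 57735 / 100000 < s < 70711 / 100000.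
Proof. destruct hs; split; nra. Qed.

Lemma cs_range : 0 < cs s < 1.
Proof. unfold cs; lra. Qed.

Lemma m_pos : 0 < (2 * s - 1) * (6 * s ^ 3 + 6 * s ^ 2 - 1).
Proof.
assert (h := s_bounds); apply Rmult_lt_0_compat; [lra|].
destruct hs as [h0 h1]; assert (0 < s ^ 3) by now apply pow_lt.
lra.
Qed.

Lemma C_pos l : nth 0 l 0 = s -> 0 < eval (xC xs) l.
Proof. intros h; cbn; rewrite h; lra. Qed.

Lemma E_pos l : nth 0 l 0 = s -> 0 < eval (xE xs) l.
Proof. intros h; cbn; rewrite h; lra. Qed.

Lemma E3_pos l : nth 0 l 0 = s -> 0 < eval xE3 l.
Proof. intros h; apply (pow_lt _ 3); now apply E_pos. Qed.

Lemma mu_pos : 0 < mu s.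
Proof. unfold mu; apply Rdiv_lt_0_compat; [apply pow_lt|]; lra. Qed.

Lemma mu_lt1 : mu s < 1.
Proof.
unfold mu; assert (h : (1 - 2 * s ^ 2) ^ 3 <= 1 ^ 3) by (apply pow_incr; lra); lra.
Qed.

Lemma quot_pos k e g : 0 < k -> 0 < e -> 0 < g -> 0 < k * e / g.
Proof. intros; apply Rdiv_lt_0_compat; auto; now apply Rmult_lt_0_compat. Qed.

Section Family_values.
Variables (a b u v : expr) (l : list R) (x : R).
Hypothesis hl : nth 0 l 0 = s.
Hypothesis hb : 0 < eval b l.
Hypothesis hx : eval a l = x * eval b l.
Hypothesis hv : 0 < eval v l.

Let hm : 0 < eval (xm b) l.
Proof.
unfold xm; cbn [eval xD xs]; rewrite hl.
rewrite Rmult_assoc; apply Rmult_lt_0_compat; [exact hb|exact m_pos].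
Qed.

Let hR : 3 * eval (xm b) l ^ 2 - eval (xn a b) l ^ 2 = eval (xC xs) l * eval (xR a b) l.
Proof. unfold xm, xn, xR, xC, xE, xD; cbn [eval]; ring. Qed.

Let hc : eval (ECst 2) l * eval (xC xs) l = cs s.
Proof. cbn; rewrite hl; reflexivity. Qed.

Lemma fam_d : eval (xn a b) l / (2 * eval (xm b) l) = dl s x.
Proof.
assert (h := m_pos); unfold dl, xn, xm; cbn [eval xC xE xD xs]; rewrite hl, hx.
field; split; [|split]; intros e; rewrite e in *; lra.
Qed.

Ltac family lem :=
  let H := fresh in
  generalize (lem (ECst 2) (xC xs) (xR a b) (xn a b) (xm b) u v l);
  rewrite hc, fam_d; intros H;
  rewrite H; [|lra|lra|exact hR]; clear H.

Ltac posprod :=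
  repeat match goal with
  | |- 0 < _ * _ => apply Rmult_lt_0_compat
  | |- 0 < _ ^ _ => apply pow_lt
  | |- 0 < eval (ECst _) _ => cbn [eval]
  | |- 0 < eval (xC xs) _ => now apply C_pos
  end; lra.

Lemma famN_pos : 0 < eval (famN a b u v) l -> 0 < Nf (cs s) (eval u l / eval v l) (dl s x).
Proof. intros h; family eval_xN; apply quot_pos; [posprod|exact h|posprod]. Qed.

Lemma famDd_pos : 0 < eval (famDd a b u v) l -> 0 < Dd (cs s) (eval u l / eval v l) (dl s x).
Proof. intros h; family eval_xDd; apply quot_pos; [posprod|exact h|posprod]. Qed.

Lemma famDu_pos : 0 < eval (famDu a b u v) l -> 0 < Du (cs s) (eval u l / eval v l) (dl s x).
Proof. intros h; family eval_xDu; apply quot_pos; [posprod|exact h|posprod]. Qed.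

Lemma famDu_neg : eval (famDu a b u v) l < 0 -> Du (cs s) (eval u l / eval v l) (dl s x) < 0.
Proof.
intros h; family eval_xDu; apply Ropp_lt_cancel; rewrite Ropp_0.
rewrite <- Rdiv_opp_l, Ropp_mult_distr_r; apply quot_pos; [posprod| |posprod].
unfold famDu in h; lra.
Qed.

Lemma famK_pos y z :
  0 < eval (famK a b u v y z) l ->
  eval z l ^ 2 * Sf (cs s) (eval u l / eval v l) (dl s x) ^ 3
  < (Nf (cs s) (eval u l / eval v l) (dl s x) * eval y l) ^ 2.
Proof.
intros h; apply Rlt_0_minus.
generalize (eval_xK (ECst 2) (xC xs) (xR a b) (xn a b) (xm b) u v l);
rewrite hc, fam_d; intros H; rewrite H; [|lra|lra|exact hR].
apply quot_pos; [posprod|exact h|posprod].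
Qed.

Lemma famQ_value y z :
  exists k, 0 < k /\
  cs s * eval y l * (3 - 2 * cs s * dl s x) ^ 2 - 2 * eval z l * (3 - 4 * dl s x ^ 2)
  = k * eval (famQ a b y z) l.
Proof.
generalize (eval_xQ (ECst 2) (xC xs) (xR a b) (xn a b) (xm b) l).
rewrite hc, fam_d; intros H; exists (eval (xC xs) l / eval (xm b) l ^ 2); split.
- apply Rdiv_lt_0_compat; posprod.
- rewrite H; [unfold famQ, Rdiv; ring|lra|exact hR].
Qed.
End Family_values.

Ltac inbox := generalize s_bounds; cbn; repeat split; lra.

Ltac use_check H l k :=
  assert (k := check_ok _ _ _ _ s l H eq_refl);
  match type of k with ?P -> ?Q -> _ =>
    let h1 := fresh in let h2 := fresh in
    assert (h1 : P) by inbox;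
    assert (h2 : Q) by (first [now apply E_pos | now apply E3_pos | cbn; lra]);
    specialize (k h1 h2); clear h1 h2
  end.

Lemma dl_pos x : -1 / 3 < x < 1 / 3 -> 0 < dl s x.
Proof.
intros hx; use_check check_n [x] h.
rewrite <- (fam_d (EVar 1) (ECst 1) [s; x] x); [|reflexivity|cbn; lra|cbn; ring].
apply Rdiv_lt_0_compat; [exact h|].
assert (hm := m_pos); unfold xm; cbn [eval xD xs nth]; lra.
Qed.

(** [c / 2] is the critical point of the curvature at [t = 0] as a function of [d]; from there up to
    the cusp the error at [0] increases. *)
Lemma dl_mid x : -1 / 3 < x < 1 / 3 -> cs s / 2 < dl s x.
Proof.
intros hx; use_check check_mid [x] h; assert (hm := m_pos).
cbn [eval xn xm xC xE xD xs nth] in h; unfold dl.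
set (m := (2 * s - 1) * (6 * s ^ 3 + 6 * s ^ 2 - 1)) in *.
apply Rmult_lt_reg_r with (2 * m); [lra|].
unfold Rdiv at 2; rewrite Rmult_assoc, Rinv_l by lra.
unfold cs; unfold m in *; lra.
Qed.

(** At [d = 3 / (2 c)] the curve has [p' = 0] at [t = 0]; the family stays below this value. *)
Lemma dl_cusp x : -1 / 3 < x < 1 / 3 -> 0 < 3 - 2 * cs s * dl s x.
Proof.
intros hx; use_check check_cusp [x] h; assert (hm := m_pos).
cbn [eval xn xm xC xE xD xs nth] in h; unfold dl.
set (m := (2 * s - 1) * (6 * s ^ 3 + 6 * s ^ 2 - 1)) in *.
set (n := (3 * s + 2) * _ - _).
replace (3 - 2 * cs s * (n / (2 * m))) with ((3 * m - cs s * n) / m) by (field; lra).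
apply Rdiv_lt_0_compat; [|exact hm].
unfold cs, n; unfold m in *; lra.
Qed.

Lemma Nf_pos x u : -1 / 3 < x < 1 / 3 -> 0 < u < 1 -> 0 < Nf (cs s) u (dl s x).
Proof.
intros hx hu; use_check check_N [x; u] h; apply (famN_pos _ _ _ _ _ x) in h.
- cbn [eval nth] in h; now rewrite Rdiv_1_r in h.
- reflexivity.
- cbn; lra.
- cbn; ring.
- cbn; lra.
Qed.

Lemma Dd_pos x u : -1 / 3 < x < 1 / 3 -> 4 / 19 < u < 1 -> 0 < Dd (cs s) u (dl s x).
Proof.
intros hx hu; use_check check_Dd [x; u] h; apply (famDd_pos _ _ _ _ _ x) in h.
- cbn [eval nth] in h; now rewrite Rdiv_1_r in h.
- reflexivity.
- cbn; lra.
- cbn; ring.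
- cbn; lra.
Qed.

Lemma Du_pos_3_14 x : (9 - 10 * s) / 86 < x < 1 / 8 -> 0 < Du (cs s) (3 / 14) (dl s x).
Proof.
intros hx; use_check check_Du_3_14 [86 * x - 9 + 10 * s] h.
apply (famDu_pos _ _ _ _ _ x) in h; [exact h|reflexivity|cbn; lra|cbn; ring|cbn; lra].
Qed.

Lemma Du_neg_2_5 x : 0 < x < 1 / 8 -> Du (cs s) (2 / 5) (dl s x) < 0.
Proof.
intros hx; use_check check_Du_2_5 [x] h.
assert (h' : eval (famDu (EVar 1) (ECst 1) (ECst 2) (ECst 5)) [s; x] < 0)
  by (cbn [eval] in h; lra).
apply (famDu_neg _ _ _ _ _ x) in h'; [exact h'|reflexivity|cbn; lra|cbn; ring|cbn; lra].
Qed.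

Lemma Du_pos_1 x : 0 < x < 1 / 8 -> 0 < Du (cs s) 1 (dl s x).
Proof.
intros hx; use_check check_Du_1 [x] h.
apply (famDu_pos _ _ _ _ _ x) in h; [|reflexivity|cbn; lra|cbn; ring|cbn; lra].
cbn [eval] in h; now rewrite Rdiv_1_r in h.
Qed.

(* The sign of [gap0 r d] decides whether the curvature at [t = 0] is below or above
   [1 + r]. *)
Definition gap0 (r d : R) := cs s * (1 + r) * (3 - 2 * cs s * d) ^ 2 - 2 * (3 - 4 * d ^ 2).

Lemma gap0_famQ r x a b y :
  0 < eval b [s] -> eval a [s] = x * eval b [s] ->
  eval y [s] = 2 * (1 + r) ->
  exists k, 0 < k /\ gap0 r (dl s x) = k * eval (famQ a b y (ECst 2)) [s].
Proof.
intros hb hx hy.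
destruct (famQ_value a b [s] x eq_refl hb hx y (ECst 2)) as [k [hk e]].
exists (k / 2); split; [lra|].
transitivity (k * eval (famQ a b y (ECst 2)) [s] / 2); [|field].
rewrite <- e, hy; unfold gap0; cbn [eval]; field.
Qed.

Lemma gap0_dl_third_neg : gap0 (mu s) (dl s (1 / 3)) < 0.
Proof.
use_check check_gap0_third (@nil R) h; cbn [eval] in h.
destruct (gap0_famQ (mu s) (1 / 3) (ECst 1) (ECst 3) (EAdd (ECst 2) xE3)) as [k [hk e]];
  [cbn; lra|cbn; lra|unfold mu; cbn; field|].
rewrite e; apply Ropp_lt_cancel; rewrite Ropp_0, Ropp_mult_distr_r.
apply Rmult_lt_0_compat; lra.
Qed.

Lemma gap0_dl_neg_third_pos : 0 < gap0 (- mu s) (dl s (-1 / 3)).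
Proof.
use_check check_gap0_neg_third (@nil R) h.
destruct (gap0_famQ (- mu s) (-1 / 3) (ECst (-1)) (ECst 3) (ESub (ECst 2) xE3)) as [k [hk e]];
  [cbn; lra|cbn; lra|unfold mu; cbn; field|].
rewrite e; now apply Rmult_lt_0_compat.
Qed.

Lemma gap0_dl_9_pos : 0 < gap0 (mu s) (dl s (1 / 9)).
Proof.
use_check check_gap0_9 (@nil R) h.
destruct (gap0_famQ (mu s) (1 / 9) (ECst 1) (ECst 9) (EAdd (ECst 2) xE3)) as [k [hk e]];
  [cbn; lra|cbn; lra|unfold mu; cbn; field|].
rewrite e; now apply Rmult_lt_0_compat.
Qed.

Lemma gap0_dL_neg : gap0 (mu s) (dL s) < 0.
Proof.
use_check check_gap0_dL (@nil R) h; cbn [eval] in h.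
generalize (eval_xQ (xc xs) (ECst 1) (ESub (ECst 3) (EPow (EMul (ECst 2) (xL xs)) 2))
  (EMul (ECst 2) (xL xs)) (ECst 1) [s] ltac:(cbn; lra) ltac:(cbn; ring)
  (EAdd (ECst 2) xE3) (ECst 2)).
match type of h with 0 < 0 - ?e => set (v := e) in * end; intros e.
assert (E : 2 * gap0 (mu s) (dL s) = v).
{ transitivity (eval (ECst 1) [s] * v / eval (ECst 1) [s] ^ 2); [|cbn; field].
  rewrite <- e; unfold gap0, mu, cs, dL; cbn; field. }
lra.
Qed.

(** [Bf] is affine in [u], with the values [3 - 2 c d] at [0] and [4 c d] at [1]. *)
Lemma Bf_pos c u d : 0 < c * d -> 0 < 3 - 2 * c * d -> 0 <= u <= 1 -> 0 < Bf c u d.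
Proof.
intros h1 h2 hu; replace (Bf c u d) with ((1 - u) * (3 - 2 * c * d) + u * (4 * (c * d)))
  by (unfold Bf; ring).
destruct (Req_dec u 0) as [->|hu0]; [lra|].
apply Rplus_le_lt_0_compat; [apply Rmult_le_pos|apply Rmult_lt_0_compat]; lra.
Qed.

Lemma Sf_pos c u d : 0 < c < 1 -> 0 <= u -> Bf c u d <> 0 -> 0 < Sf c u d.
Proof.
intros hc hu hB; unfold Sf.
assert (0 <= Af c u d ^ 2) by apply pow2_ge_0.
assert (0 < Bf c u d ^ 2) by now apply pow2_gt_0.
assert (0 <= (1 - c ^ 2) * u * Af c u d ^ 2)
  by (apply Rmult_le_pos; [apply Rmult_le_pos; nra|assumption]).
assert (0 < c ^ 2 * Bf c u d ^ 2) by (apply Rmult_lt_0_compat; nra).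
lra.
Qed.

Lemma kap_gt c u d y z :
  0 < Sf c u d -> 0 < Nf c u d -> 0 < y ->
  z ^ 2 * Sf c u d ^ 3 < (Nf c u d * y) ^ 2 -> z / y < kap c u d.
Proof.
intros hS hN hy h; unfold kap; set (q := sqrt (Sf c u d ^ 3)).
assert (hq : 0 < q) by now apply sqrt_lt_R0, pow_lt.
assert (e : q ^ 2 = Sf c u d ^ 3) by (apply pow2_sqrt, Rlt_le; now apply pow_lt).
assert (h1 : z * q < Nf c u d * y).
{ destruct (Rlt_le_dec (z * q) (Nf c u d * y)) as [|h2]; [assumption|].
  assert (h3 : (Nf c u d * y) ^ 2 <= (z * q) ^ 2)
    by (apply pow_incr; split; [apply Rlt_le; now apply Rmult_lt_0_compat|exact h2]).
  rewrite (Rpow_mult_distr z q), e in h3; lra. }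
apply Rmult_lt_reg_r with (y * q); [now apply Rmult_lt_0_compat|].
replace (z / y * (y * q)) with (z * q) by (field; lra).
replace (Nf c u d / q * (y * q)) with (Nf c u d * y) by (field; lra).
exact h1.
Qed.

Lemma cd_pos x : -1 / 3 < x < 1 / 3 -> 0 < cs s * dl s x.
Proof. intros hx; apply Rmult_lt_0_compat; [apply cs_range|now apply dl_pos]. Qed.

Lemma Sf_dl_pos x u : -1 / 3 < x < 1 / 3 -> 0 <= u <= 1 -> 0 < Sf (cs s) u (dl s x).
Proof.
intros hx hu; apply Sf_pos; [exact cs_range|lra|].
apply Rgt_not_eq, Bf_pos; [now apply cd_pos|now apply dl_cusp|exact hu].
Qed.

(** [dl s (1 / 9)] lies below [I_c], so monotonicity in [d] turns this into the bound [mu s] for the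
    local maximum on all of [I_c]. *)
Lemma kap_dl_9 u : 0 < u < 1 / 2 -> 1 - mu s < kap (cs s) u (dl s (1 / 9)).
Proof.
intros hu; use_check check_kap_9 [u] h.
apply (famK_pos _ _ _ _ _ (1 / 9)) in h; [|reflexivity|cbn; lra|cbn; lra|cbn; lra].
replace (eval (EVar 1) [s; u] / eval (ECst 1) [s; u]) with u in h by (cbn; field).
apply kap_gt in h; [|apply Sf_dl_pos; lra|apply Nf_pos; lra|cbn; lra].
replace (1 - mu s) with (eval (ESub (ECst 2) xE3) [s; u] / eval (ECst 2) [s; u]);
  [exact h|unfold mu; cbn; field].
Qed.

Lemma kap_dl_23 u : 1 / 5 < u < 2 / 5 -> 1 - beta s < kap (cs s) u (dl s (1 / 23)).
Proof.
intros hu; use_check check_kap_23 [u] h.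
apply (famK_pos _ _ _ _ _ (1 / 23)) in h; [|reflexivity|cbn; lra|cbn; lra|cbn; lra].
replace (eval (EVar 1) [s; u] / eval (ECst 1) [s; u]) with u in h by (cbn; field).
apply kap_gt in h; [|apply Sf_dl_pos; lra|apply Nf_pos; lra|cbn; lra].
replace (1 - beta s) with (eval (ESub (ECst 22) xbeta) [s; u] / eval (ECst 22) [s; u]);
  [exact h|unfold beta; cbn; field].
Qed.

(** One sample point suffices, as the local minimum is at most the value there. *)
Lemma kap_dl_23_4_5 : 1 + beta s < kap (cs s) (4 / 5) (dl s (1 / 23)).
Proof.
use_check check_kap_23_4_5 (@nil R) h.
apply (famK_pos _ _ _ _ _ (1 / 23)) in h; [|reflexivity|cbn; lra|cbn; lra|cbn; lra].
replace (eval (ECst 4) [s] / eval (ECst 5) [s]) with (4 / 5) in h by (cbn; field).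
apply kap_gt in h; [|apply Sf_dl_pos; lra|apply Nf_pos; lra|cbn; lra].
replace (1 + beta s) with (eval (EAdd (ECst 22) xbeta) [s] / eval (ECst 22) [s]);
  [exact h|unfold beta; cbn; field].
Qed.

(** For smaller [s] no [d] satisfies [0 < d < dL s], so the certificates for [xlow] need to cover
    [s] only from here on. *)
Lemma dL_pos_s : 0 < dL s -> 11 / 17 < s.
Proof.
intros h; destruct (Rlt_le_dec (11 / 17) s) as [|h']; [assumption|exfalso].
destruct hs as [h0 h1]; unfold dL in h.
assert (s ^ 2 <= (11 / 17) ^ 2) by (apply pow_incr; lra).
assert (s ^ 3 <= (11 / 17) ^ 3) by (apply pow_incr; lra).
nra.
Qed.

Lemma dL_le : dL s < 3 / 5.
Proof. destruct hs as [h0 h1]; assert (h := s_bounds); unfold dL; nra. Qed.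

Lemma kap_low d : 0 < d < dL s -> 1 + mu s < kap (cs s) (4 / 5) d.
Proof.
intros hd; assert (hL : 0 < dL s) by lra; assert (hs' := dL_pos_s hL).
assert (hsb := s_bounds); assert (hc := cs_range).
set (z := 1 - d / dL s).
assert (hz : 0 < z < 1).
{ unfold z; assert (0 < d / dL s) by (apply Rdiv_lt_0_compat; lra).
  assert (d / dL s < 1) by (apply Rmult_lt_reg_r with (dL s); [exact hL|];
    unfold Rdiv; rewrite Rmult_assoc, Rinv_l; lra).
  lra. }
set (R1 := ESub (ECst 3) (EPow xnlow 2)).
assert (hS : 0 < Sf (cs s) (4 / 5) d).
(* No cusp occurs: [d < 3 / 5] and [c < 1] give [3 - 2 c d > 0]. *)
{ apply Sf_pos; [exact hc|lra|]; apply Rgt_not_eq, Bf_pos; [|assert (h := dL_le)|lra].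
  - now apply Rmult_lt_0_compat.
  - nra. }
assert (ed : eval xnlow [z; s] / (2 * eval (ECst 1) [z; s]) = d).
{ unfold z; cbn; fold (cs s); field_simplify_eq; unfold dL in *; [ring|lra]. }
assert (ec : eval (xc (EVar 1)) [z; s] * eval (ECst 1) [z; s] = cs s) by (unfold cs; cbn; ring).
assert (eu : eval (ECst 4) [z; s] / eval (ECst 5) [z; s] = 4 / 5) by (cbn; field).
assert (e1 : eval (ECst 1) [z; s] <> 0) by (cbn; lra).
assert (e5 : eval (ECst 5) [z; s] <> 0) by (cbn; lra).
assert (eR : 3 * eval (ECst 1) [z; s] ^ 2 - eval xnlow [z; s] ^ 2
             = eval (ECst 1) [z; s] * eval R1 [z; s]) by (unfold R1; cbn [eval]; ring).
assert (hN : 0 < Nf (cs s) (4 / 5) d).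
{ assert (h := check_ok _ _ _ _ z [s] check_lowN eq_refl).
  generalize (eval_xN (xc (EVar 1)) (ECst 1) R1 xnlow (ECst 1) (ECst 4) (ECst 5) [z; s] e1 e5 eR).
  rewrite ec, ed, eu; intros ->.
  apply quot_pos; [|apply h; [cbn; repeat split; lra|cbn; lra]|cbn; lra].
  assert (0 < eval (xc (EVar 1)) [z; s]) by (unfold cs in hc; cbn; lra).
  apply Rmult_lt_0_compat; [|cbn; lra].
  apply Rmult_lt_0_compat; [lra|now apply pow_lt]. }
replace (1 + mu s) with ((2 + (1 - 2 * s ^ 2) ^ 3) / 2) by (unfold mu; field).
apply kap_gt; [exact hS|exact hN|lra|].
apply Rlt_0_minus.
generalize (eval_xK (xc (EVar 1)) (ECst 1) R1 xnlow (ECst 1) (ECst 4) (ECst 5) [z; s] e1 e5 eR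
  (ECst 2) (EAdd (ECst 2) (EPow (xE (EVar 1)) 3))).
rewrite ec, ed, eu; intros E.
match goal with |- 0 < ?g => replace g with (1 ^ 6 * eval xlow [z; s] / (1 ^ 12 * 5 ^ 9)) end.
apply quot_pos; [lra|apply xlow_pos; [exact hz|exact hs'|]|lra].
destruct hs; cbn; lra.
Qed.

(** The ends of [I_c] are the zero [dl s 0] with [6 s] replaced by a polynomial in [c]: the linear
    interpolant, equal to [2 sqrt 3] at [c = 0] and [3 sqrt 2] at [c = 1], plus a correction
    [c (1 - c) r]. Hence the difference vanishes at both ends of the range of [s], and the factors
    responsible can be split off with their known sign. *)
Lemma endpoint_sub s2 s3 r x : s2 * s2 = 2 -> s3 * s3 = 3 ->
  let c := cs s in
  let m := (2 * s - 1) * (6 * s ^ 3 + 6 * s ^ 2 - 1) in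
  let q := (3 * s + s3) * (2 * s + s2) in
  (3 * c ^ 2 + (1 - c) * (2 * s3 * (1 - c) + 3 * s2 * c + c * (1 - c) * r))
    / (2 * (c ^ 3 + 2)) - dl s x =
  (1 - 2 * s ^ 2) * ((3 * s - s3) * (s2 - 2 * s)) / (12 * (c ^ 3 + 2) * m)
  * (18 * (q * r - (3 * s2 - 2 * s3)) * m + x * q * (c ^ 3 + 2)).
Proof.
intros h2 h3 c m q.
assert (hm : 0 < m) by exact m_pos.
assert (hc : 0 < c ^ 3 + 2).
{ assert (h : 0 < c) by (apply cs_range); apply (pow_lt c 3) in h; lra. }
set (E := 1 - 2 * s ^ 2); set (P := (3 * s - s3) * (s2 - 2 * s)).
(* The first fraction is the quadratic formula, with [6 s] for the square root of [6 (c + 2)]. *)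
assert (ed : dl s x = (3 * c ^ 2 + (1 - c) * (6 * s)) / (2 * (c ^ 3 + 2))
                      - x * ((3 * s ^ 2 - 1) * E) * E / (2 * m)).
{ unfold dl; fold m; fold E; apply Rmult_eq_reg_r with (2 * (c ^ 3 + 2) * m); [|nra].
  field_simplify_eq; [|lra]; unfold c, m, E, cs; ring. }
(* Quadratic in [s] and zero at both ends, hence a constant multiple of [P]. *)
assert (ek : 6 * s - 2 * s3 * (1 - c) - 3 * s2 * c = P * (3 * s2 - 2 * s3)).
{ apply Rminus_diag_uniq.
  replace (_ - _) with (- ((9 * s - 3 * s3) * (s2 * s2 - 2) + (2 * s2 - 4 * s) * (s3 * s3 - 3)))
    by (unfold P, c, cs; ring).
  rewrite h2, h3; ring. }
assert (eq : 6 * ((3 * s ^ 2 - 1) * E) = P * q).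
{ apply Rminus_diag_uniq.
  replace (_ - _) with ((s3 * s3 - 3) * (s2 * s2 - 4 * s ^ 2) + (3 - 9 * s ^ 2) * (s2 * s2 - 2))
    by (unfold P, q, E; ring).
  rewrite h2, h3; ring. }
assert (ec : 1 - c = 3 * E) by (unfold c, cs, E; ring).
assert (ec' : c * (1 - c) = P * q) by (rewrite <- eq; unfold c, cs, E; ring).
rewrite ed, ec', ec.
replace ((3 * s ^ 2 - 1) * E) with (P * q / 6) by (rewrite <- eq; field).
replace (2 * s3 * (3 * E) + 3 * s2 * c + P * q * r)
  with (6 * s - P * (3 * s2 - 2 * s3) + P * q * r) by (rewrite <- ek, <- ec; ring).
clearbody P E q c m; field; lra.
Qed.

Lemma sqrt_boxes :
  141421 / 100000 < sqrt 2 < 141422 / 100000 /\ 173205 / 100000 < sqrt 3 < 173206 / 100000.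
Proof.
assert (h2 := sqrt_sqrt 2 ltac:(lra)); assert (h3 := sqrt_sqrt 3 ltac:(lra)).
assert (p2 := sqrt_pos 2); assert (p3 := sqrt_pos 3).
repeat split; nra.
Qed.

Lemma corner_factor_pos : 0 < (3 * s - sqrt 3) * (sqrt 2 - 2 * s).
Proof.
assert (h2 := sqrt_sqrt 2 ltac:(lra)); assert (h3 := sqrt_sqrt 3 ltac:(lra)).
assert (p2 := sqrt_pos 2); assert (p3 := sqrt_pos 3); destruct hs as [h0 h1].
apply Rmult_lt_0_compat; nra.
Qed.

Lemma endpoint_sign D r0 r1 r2 L x a b :
  let l := [s; sqrt 2; sqrt 3] in
  let c := cs s in
  let r := (eval r0 l + eval r1 l * c + eval r2 l * c ^ 2) / IZR L in
  0 < IZR L -> 0 < eval b l -> eval a l = x * eval b l ->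
  D = (3 * c ^ 2 + (1 - c) * (2 * sqrt 3 * (1 - c) + 3 * sqrt 2 * c + c * (1 - c) * r))
      / (2 * (c ^ 3 + 2)) ->
  exists k, 0 < k /\ D - dl s x = k * eval (xends L r0 r1 r2 a b) l.
Proof.
intros l c r hL hb ha ->.
assert (h2 := sqrt_sqrt 2 ltac:(lra)); assert (h3 := sqrt_sqrt 3 ltac:(lra)).
assert (hm := m_pos); assert (hP := corner_factor_pos); destruct hs as [h0 h1].
set (m := (2 * s - 1) * (6 * s ^ 3 + 6 * s ^ 2 - 1)) in *.
assert (hc : 0 < c ^ 3 + 2).
{ assert (h : 0 < c) by (apply cs_range); apply (pow_lt c 3) in h; lra. }
exists ((1 - 2 * s ^ 2) * ((3 * s - sqrt 3) * (sqrt 2 - 2 * s)) / (12 * (c ^ 3 + 2) * m)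
        / (IZR L * eval b l)); split.
- apply Rdiv_lt_0_compat; [|now apply Rmult_lt_0_compat].
  apply Rdiv_lt_0_compat; apply Rmult_lt_0_compat; auto; lra.
- unfold c; rewrite (endpoint_sub (sqrt 2) (sqrt 3) r x h2 h3); fold c; fold m.
  unfold xends; cbn [eval]; rewrite ha.
  change (eval (xc xs) l) with (6 * s ^ 2 - 2).
  replace (6 * s ^ 2 - 2) with c by (unfold c, cs; ring).
  change (eval xs l) with s; change (nth 1 l 0) with (sqrt 2).
  change (nth 2 l 0) with (sqrt 3).
  change (eval (xD xs) l) with (6 * s ^ 3 + 6 * s ^ 2 - 1).
  unfold r; generalize (eval r0 l) (eval r1 l) (eval r2 l); intros v0 v1 v2.
  clearbody c; unfold m; field; unfold m in hm.
  repeat split; try lra; intros e; rewrite e in hm; lra.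
Qed.

Lemma dl_9_lt_d1 : dl s (1 / 9) < Defs.d1 (cs s).
Proof.
assert (hb := s_bounds); assert (hq := sqrt_boxes); assert (hc := cs_range).
assert (h := check_ok _ _ _ _ s [sqrt 2; sqrt 3] check_d1 eq_refl).
unfold xd1 in h.
assert (hc3 : 0 < cs s ^ 3) by (apply pow_lt; lra).
edestruct (endpoint_sign (Defs.d1 (cs s))) with (L := 96%Z) (x := 1 / 9) as [k [hk e]].
5: { apply Rlt_0_minus; rewrite e; apply Rmult_lt_0_compat; [exact hk|].
     apply h; [cbn; lra|cbn; lra]. }
- lra.
- cbn; lra.
- cbn; lra.
- unfold Defs.d1; cbn; field; lra.
Qed.

Lemma dl_23_lt_d2 : dl s (1 / 23) < Defs.d2 (cs s).
Proof.
assert (hb := s_bounds); assert (hq := sqrt_boxes); assert (hc := cs_range).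
assert (hc3 : 0 < cs s ^ 3) by (apply pow_lt; lra).
edestruct (endpoint_sign (Defs.d2 (cs s))) with (L := 60%Z) (x := 1 / 23) (a := ECst 1)
  (b := ECst 23) as [k [hk e]].
5: { apply Rlt_0_minus; rewrite e; apply Rmult_lt_0_compat; [exact hk|].
     destruct (Rlt_le_dec s (65 / 100)).
     - apply (check_ok _ _ _ _ s [sqrt 2; sqrt 3] check_d2_lower1 eq_refl);
         [cbn; lra|cbn; lra].
     - apply (check_ok _ _ _ _ s [sqrt 2; sqrt 3] check_d2_lower2 eq_refl);
         [cbn; lra|cbn; lra]. }
- lra.
- cbn; lra.
- cbn; lra.
- unfold Defs.d2; cbn; field; lra.
Qed.

Lemma d2_lt_dl : Defs.d2 (cs s) < dl s ((9 - 10 * s) / 86).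
Proof.
assert (hb := s_bounds); assert (hq := sqrt_boxes); assert (hc := cs_range).
assert (hc3 : 0 < cs s ^ 3) by (apply pow_lt; lra).
edestruct (endpoint_sign (Defs.d2 (cs s))) with (L := 60%Z) (x := (9 - 10 * s) / 86)
  (a := ESub (ECst 9) (EMul (ECst 10) xs)) (b := ECst 86) as [k [hk e]].
5: { apply Rlt_0_minus.
     match type of e with _ = k * ?v => assert (hv : 0 < 0 - v) end.
     { destruct (Rlt_le_dec s (65 / 100)).
       - apply (check_ok _ _ _ _ s [sqrt 2; sqrt 3] check_d2_upper1 eq_refl);
           [cbn; lra|cbn; lra].
       - apply (check_ok _ _ _ _ s [sqrt 2; sqrt 3] check_d2_upper2 eq_refl);
           [cbn; lra|cbn; lra]. }
     apply (Rmult_lt_0_compat _ _ hk) in hv; lra. }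
- lra.
- cbn; lra.
- cbn; field.
- unfold Defs.d2; cbn; field; lra.
Qed.
End Fixed_s.

(** * Functions with one interior maximum and one interior minimum *)

Lemma is_derive_pos_near (f : R -> R) (x l : R) : is_derive f x l -> 0 < l ->
  exists e, 0 < e /\ (forall y, x < y < x + e -> f x < f y) /\
            (forall y, x - e < y < x -> f y < f x).
Proof.
intros h hl; apply is_derive_Reals in h.
destruct (h l hl) as [e he]; exists e; split; [apply cond_pos|].
assert (hy : forall y, y <> x -> Rabs (y - x) < e -> 0 < (f y - f x) / (y - x)).
{ intros y hy hye; specialize (he (y - x) ltac:(lra) hye).
  replace (x + (y - x)) with y in he by ring; apply Rabs_def2 in he; lra. }
split; intros y hxy.
- specialize (hy y ltac:(lra) ltac:(rewrite Rabs_pos_eq; lra)).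
  apply Rmult_lt_compat_r with (r := y - x) in hy; [|lra].
  unfold Rdiv in hy; rewrite Rmult_assoc, Rinv_l in hy; lra.
- specialize (hy y ltac:(lra) ltac:(rewrite Rabs_left; lra)).
  apply Rmult_lt_compat_r with (r := x - y) in hy; [|lra].
  replace ((f y - f x) / (y - x) * (x - y)) with (f x - f y) in hy by (field; lra); lra.
Qed.

Lemma is_derive_neg_near (f : R -> R) (x l : R) : is_derive f x l -> l < 0 ->
  exists e, 0 < e /\ (forall y, x < y < x + e -> f y < f x) /\
            (forall y, x - e < y < x -> f x < f y).
Proof.
intros h hl; apply (is_derive_opp f) in h.
destruct (is_derive_pos_near _ _ _ h) as [e [he [h1 h2]]].
{ change (opp l) with (- l); lra. }
change opp with Ropp in *; exists e; split; [exact he|]; split; intros y hy.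
- specialize (h1 y hy); lra.
- specialize (h2 y hy); lra.
Qed.

Lemma local_max_interior f a b t : a < t < b ->
  (forall y, a <= y <= b -> f y <= f t) -> is_local_max f t.
Proof.
intros ht h; apply (locally_interval _ t a b); [apply ht|apply ht|].
intros y h1 h2; simpl in h1, h2; apply h; lra.
Qed.

Lemma local_min_interior f a b t : a < t < b ->
  (forall y, a <= y <= b -> f t <= f y) -> is_local_min f t.
Proof.
intros ht h; apply (locally_interval _ t a b); [apply ht|apply ht|].
intros y h1 h2; simpl in h1, h2; apply h; lra.
Qed.

Section Shape.
Variables (f : R -> R) (tm tM t1 t2 l1 l2 l3 : R).
Hypothesis ht : 0 < t1 < t2 /\ t2 < 1.
Hypothesis hf : forall t, 0 <= t <= 1 -> continuity_pt f t.
Hypothesis (h1 : is_derive f t1 l1) (hl1 : 0 < l1).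
Hypothesis (h2 : is_derive f t2 l2) (hl2 : l2 < 0).
Hypothesis (h3 : is_derive f 1 l3) (hl3 : 0 < l3).
Hypothesis hM : unique (fun u => 0 < u < 1 /\ is_local_max f u) tM.
Hypothesis hm : unique (fun u => 0 < u < 1 /\ is_local_min f u) tm.

Let max_at a b t : 0 <= a -> b <= 1 -> a < t < b ->
  (forall y, a <= y <= b -> f y <= f t) -> tM = t.
Proof.
intros ha hb hab h; apply hM; split; [lra|now apply local_max_interior with a b].
Qed.

Let min_at a b t : 0 <= a -> b <= 1 -> a < t < b ->
  (forall y, a <= y <= b -> f t <= f y) -> tm = t.
Proof.
intros ha hb hab h; apply hm; split; [lra|now apply local_min_interior with a b].
Qed.

(** The signs of the derivative push the maximum over [[t1, t2]] off the ends, so it is an interior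
    local maximum, and there is only one. *)
Lemma shape_max : t1 < tM < t2 /\ forall t, t1 <= t <= t2 -> f t <= f tM.
Proof.
destruct (continuity_ab_maj f t1 t2) as [y [hy1 hy2]]; [lra|intros; apply hf; lra|].
destruct (is_derive_pos_near _ _ _ h1 hl1) as [e1 [he1 [hr _]]].
destruct (is_derive_neg_near _ _ _ h2 hl2) as [e2 [he2 [_ hr2]]].
set (z1 := t1 + Rmin e1 (t2 - t1) / 2); set (z2 := t2 - Rmin e2 (t2 - t1) / 2).
assert (0 < Rmin e1 (t2 - t1)) by (apply Rmin_pos; lra).
assert (0 < Rmin e2 (t2 - t1)) by (apply Rmin_pos; lra).
generalize (Rmin_l e1 (t2 - t1)) (Rmin_r e1 (t2 - t1))
  (Rmin_l e2 (t2 - t1)) (Rmin_r e2 (t2 - t1)); intros.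
assert (hy : t1 < y < t2).
{ split.
  - destruct (Req_dec y t1) as [e|]; [|lra]; exfalso.
    generalize (hr z1 ltac:(unfold z1; lra)) (hy1 z1 ltac:(unfold z1; lra)); rewrite e; lra.
  - destruct (Req_dec y t2) as [e|]; [|lra]; exfalso.
    generalize (hr2 z2 ltac:(unfold z2; lra)) (hy1 z2 ltac:(unfold z2; lra)); rewrite e; lra. }
rewrite (max_at t1 t2 y); auto; lra.
Qed.

Lemma shape_min : t2 < tm < 1 /\ forall t, t2 <= t <= 1 -> f tm <= f t.
Proof.
destruct (continuity_ab_min f t2 1) as [y [hy1 hy2]]; [lra|intros; apply hf; lra|].
destruct (is_derive_neg_near _ _ _ h2 hl2) as [e1 [he1 [hr _]]].
destruct (is_derive_pos_near _ _ _ h3 hl3) as [e2 [he2 [_ hr2]]].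
set (z1 := t2 + Rmin e1 (1 - t2) / 2); set (z2 := 1 - Rmin e2 (1 - t2) / 2).
assert (0 < Rmin e1 (1 - t2)) by (apply Rmin_pos; lra).
assert (0 < Rmin e2 (1 - t2)) by (apply Rmin_pos; lra).
generalize (Rmin_l e1 (1 - t2)) (Rmin_r e1 (1 - t2))
  (Rmin_l e2 (1 - t2)) (Rmin_r e2 (1 - t2)); intros.
assert (hy : t2 < y < 1).
{ split.
  - destruct (Req_dec y t2) as [e|]; [|lra]; exfalso.
    generalize (hr z1 ltac:(unfold z1; lra)) (hy1 z1 ltac:(unfold z1; lra)); rewrite e; lra.
  - destruct (Req_dec y 1) as [e|]; [|lra]; exfalso.
    generalize (hr2 z2 ltac:(unfold z2; lra)) (hy1 z2 ltac:(unfold z2; lra)); rewrite e; lra. }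
rewrite (min_at t2 1 y); auto; lra.
Qed.

Lemma shape_upper t : 0 <= t <= 1 -> f t <= f tM \/ f t <= f 1.
Proof.
intros ht0; destruct shape_max as [hM1 hM2]; destruct shape_min as [hm1 hm2].
destruct (Rle_dec t t2) as [htt|htt].
- left; destruct (Rle_dec t1 t) as [htt1|htt1]; [apply hM2; lra|].
  destruct (Rle_lt_dec (f t) (f tM)) as [|hlt]; [assumption|exfalso].
  (* Just left of [t1] the function drops below [f t1], hence below both [f t] and [f tM]. The
     minimum on [[t, tM]] is then interior, and is a local minimum left of [t2], where [tm] cannot
     be. *)
  destruct (continuity_ab_min f t tM) as [y [hy1 hy2]]; [lra|intros; apply hf; lra|].
  destruct (is_derive_pos_near _ _ _ h1 hl1) as [e1 [he1 [_ hr]]].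
  assert (0 < Rmin e1 (t1 - t)) by (apply Rmin_pos; lra).
  generalize (Rmin_l e1 (t1 - t)) (Rmin_r e1 (t1 - t)); intros.
  set (z := t1 - Rmin e1 (t1 - t) / 2).
  assert (hz := hr z ltac:(unfold z; lra)); assert (hz' := hy1 z ltac:(unfold z; lra)).
  assert (hz2 := hM2 t1 ltac:(lra)).
  assert (hyt : t < y < tM).
  { split; [destruct (Req_dec y t) as [e|]|destruct (Req_dec y tM) as [e|]]; try lra;
      rewrite e in *; lra. }
  assert (tm = y) by (apply (min_at t tM); auto; lra); lra.
- destruct (continuity_ab_maj f t2 1) as [y [hy1 hy2]]; [lra|intros; apply hf; lra|].
  assert (hty := hy1 t ltac:(lra)).
  destruct (Req_dec y 1) as [->|hy1']; [now right|left].
  destruct (Req_dec y t2) as [->|hy2']; [generalize (hM2 t2 ltac:(lra)); lra|].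
  assert (tM = y) by (apply (max_at t2 1); auto; lra); lra.
Qed.

Lemma shape_lower t : 0 <= t <= 1 -> f 0 <= f t \/ f tm <= f t.
Proof.
intros ht0; destruct shape_min as [hm1 hm2].
destruct (Rle_dec t2 t) as [htt|htt]; [right; apply hm2; lra|].
destruct (continuity_ab_min f 0 t2) as [y [hy1 hy2]]; [lra|intros; apply hf; lra|].
assert (hty := hy1 t ltac:(lra)).
destruct (Req_dec y 0) as [->|hy0]; [now left|right].
destruct (Req_dec y t2) as [->|hyt]; [generalize (hm2 t2 ltac:(lra)); lra|].
assert (tm = y) by (apply (min_at 0 t2); auto; lra); lra.
Qed.
End Shape.

(* [tM] and [tm] need not be continuous; the extremal values are, because [f] is uniformly
   continuous. *)
Section Balance.
Variables (f : R -> R -> R) (tM tm : R -> R) (a b t1 t2 t3 : R).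
Hypothesis hab : a < b.
Hypothesis ht : t1 <= t2 <= t3.
Hypothesis hM : forall d, a <= d <= b ->
  t1 <= tM d <= t2 /\ forall t, t1 <= t <= t2 -> f t d <= f (tM d) d.
Hypothesis hm : forall d, a <= d <= b ->
  t2 <= tm d <= t3 /\ forall t, t2 <= t <= t3 -> f (tm d) d <= f t d.
Hypothesis hf : forall t d, t1 <= t <= t3 -> a <= d <= b -> continuity_2d_pt f t d.

(** [IVT] asks for continuity on the whole line, while the extremal values are controlled only on
    [[a, b]]. *)
Let clamp d := Rmax a (Rmin b d).

Let clamp_in d : a <= clamp d <= b.
Proof.
unfold clamp; split; [apply Rmax_l|]; apply Rmax_lub; [lra|apply Rmin_l].
Qed.

Let clamp_id d : a <= d <= b -> clamp d = d.
Proof. intros hd; unfold clamp; rewrite Rmin_right, Rmax_right; lra. Qed.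

Let clamp_lip d e : Rabs (clamp d - clamp e) <= Rabs (d - e).
Proof.
unfold clamp, Rmax, Rmin; repeat destruct Rle_dec;
  unfold Rabs; repeat destruct Rcase_abs; lra.
Qed.

Lemma balanced_parameter :
  0 < f (tM a) a + f (tm a) a -> f (tM b) b + f (tm b) b < 0 ->
  exists d, a < d < b /\ f (tM d) d + f (tm d) d = 0.
Proof.
intros ha hb.
(* Negated because [IVT] expects a change from negative to positive. *)
set (g := fun d => - (f (tM (clamp d)) (clamp d) + f (tm (clamp d)) (clamp d))).
destruct (IVT g a b) as [d [hd1 hd2]].
- intros x e he.
  assert (he2 : 0 < e / 2) by lra.
  destruct (uniform_continuity_2d f t1 t3 a b hf (mkposreal _ he2)) as [dl hdl].
  exists dl; split; [apply cond_pos|]; intros y [_ hy]; simpl in hy |- *; unfold R_dist in *.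
  assert (hc := Rle_lt_trans _ _ _ (clamp_lip y x) hy).
  assert (U : forall t, t1 <= t <= t3 -> Rabs (f t (clamp y) - f t (clamp x)) < e / 2).
  { intros t htt; apply (hdl t (clamp x) t (clamp y)); auto.
    rewrite Rminus_diag, Rabs_R0; apply cond_pos. }
  unfold g; generalize (clamp_in x) (clamp_in y); intros hx hy'.
  destruct (hM _ hx) as [M1 M2], (hM _ hy') as [M3 M4].
  destruct (hm _ hx) as [m1 m2], (hm _ hy') as [m3 m4].
  (* Comparing each slice at the extremal point of the other bounds the change of both extremal
     values by [e / 2]. *)
  assert (A1 := U (tM (clamp x)) ltac:(lra)); assert (A2 := U (tM (clamp y)) ltac:(lra)).
  assert (A3 := U (tm (clamp x)) ltac:(lra)); assert (A4 := U (tm (clamp y)) ltac:(lra)).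
  apply Rabs_def2 in A1, A2, A3, A4.
  specialize (M2 _ M3); specialize (M4 _ M1); specialize (m2 _ m3); specialize (m4 _ m1).
  apply Rabs_def1; lra.
- exact hab.
- unfold g; rewrite clamp_id; lra.
- unfold g; rewrite clamp_id; lra.
- exists d; unfold g in hd2; rewrite clamp_id in hd2 by exact hd1.
  split; [|lra].
  destruct (Req_dec d a) as [->|]; [lra|]; destruct (Req_dec d b) as [->|]; lra.
Qed.
End Balance.

(** * Dependence of the error on the parameter *)

Section Arc.
Variable s : R.
Hypothesis hs : 0 < s /\ 1 / 3 < s ^ 2 < 1 / 2.
Notation c := (cs s).

Let hc : 0 < c < 1 := cs_range s hs.

Definition in_range (d : R) := dl s (1 / 3) < d < dl s (-1 / 3).

Lemma dl_affine : exists g, 0 < g /\ forall x, dl s x = dl s 0 - x * g.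
Proof.
assert (hm := m_pos s hs); destruct hs as [h0 h1].
exists ((3 * s ^ 2 - 1) * (1 - 2 * s ^ 2) ^ 2
        / (2 * ((2 * s - 1) * (6 * s ^ 3 + 6 * s ^ 2 - 1)))); split.
- apply Rdiv_lt_0_compat; [|lra]; apply Rmult_lt_0_compat; [lra|apply pow_lt; lra].
- intros x; unfold dl; set (m := (2 * s - 1) * _) in *; field; lra.
Qed.

Lemma dl_decr x y : x < y -> dl s y < dl s x.
Proof. intros h; destruct dl_affine as [g [hg e]]; rewrite (e x), (e y); nra. Qed.

Lemma dl_between x y d : dl s y < d < dl s x -> exists z, x < z < y /\ d = dl s z.
Proof.
intros h; destruct dl_affine as [g [hg e]]; exists ((dl s 0 - d) / g).
rewrite (e x), (e y) in h; split; [split|].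
- apply Rmult_lt_reg_r with g; [exact hg|]; unfold Rdiv; rewrite Rmult_assoc, Rinv_l; lra.
- apply Rmult_lt_reg_r with g; [exact hg|]; unfold Rdiv; rewrite Rmult_assoc, Rinv_l; lra.
- rewrite e; field; lra.
Qed.

Lemma range_facts d : in_range d -> 0 < d /\ c / 2 < d /\ 0 < 3 - 2 * c * d.
Proof.
intros h; destruct (dl_between _ _ _ h) as [x [hx ->]].
split; [now apply dl_pos|split; [now apply dl_mid|now apply dl_cusp]].
Qed.

Lemma in_range_dl x : -1 / 3 < x < 1 / 3 -> in_range (dl s x).
Proof. intros hx; split; apply dl_decr; lra. Qed.

Lemma range_S d u : in_range d -> 0 <= u <= 1 -> 0 < Sf c u d.
Proof.
intros h hu; destruct (dl_between _ _ _ h) as [x [hx ->]]; now apply Sf_dl_pos.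
Qed.

Lemma e4_continuity_2d t d : in_range d -> 0 <= t <= 1 -> continuity_2d_pt (e4 c) t d.
Proof.
intros hd ht.
assert (hS : 0 < Sf c (t ^ 2) d) by (apply range_S; [exact hd|nra]).
assert (hS3 : 0 < Sf c (t ^ 2) d ^ 3) by now apply pow_lt.
apply continuity_2d_pt_ext with (fun t d => 1 - Nf c (t ^ 2) d * / sqrt (Sf c (t ^ 2) d ^ 3)).
{ intros x y; symmetry; now apply e4E. }
apply continuity_2d_pt_minus; [apply continuity_2d_pt_const|].
apply continuity_2d_pt_mult; [|apply continuity_2d_pt_inv].
- unfold Nf; cbn [pow].
  repeat (apply continuity_2d_pt_minus || apply continuity_2d_pt_plus
          || apply continuity_2d_pt_mult || apply continuity_2d_pt_const
          || apply continuity_2d_pt_id1 || apply continuity_2d_pt_id2).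
- apply (continuity_1d_2d_pt_comp sqrt (fun t d => Sf c (t ^ 2) d ^ 3)).
  + apply continuity_pt_sqrt; lra.
  + unfold Sf, Af, Bf; cbn [pow].
    repeat (apply continuity_2d_pt_minus || apply continuity_2d_pt_plus
            || apply continuity_2d_pt_mult || apply continuity_2d_pt_const
            || apply continuity_2d_pt_id1 || apply continuity_2d_pt_id2).
- apply Rgt_not_eq; now apply sqrt_lt_R0.
Qed.

Lemma e4_continuity t d : in_range d -> 0 <= t <= 1 -> continuity_pt (fun x => e4 c x d) t.
Proof.
intros hd ht; apply derivable_continuous_pt.
exists (t * Du c (t ^ 2) d / (Sf c (t ^ 2) d * sqrt (Sf c (t ^ 2) d ^ 3))).
apply is_derive_Reals, e4_derive_t; [exact hc|apply range_S; [exact hd|nra]].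
Qed.

Lemma e4_decr t d d' : 0 <= t -> 4 / 19 < t ^ 2 < 1 -> in_range d -> in_range d' -> d < d' ->
  e4 c t d' < e4 c t d.
Proof.
intros ht0 ht hd hd' hdd; rewrite !e4E by exact hc.
assert (h : kap c (t ^ 2) d < kap c (t ^ 2) d'); [|lra].
apply (incr_function (fun x => kap c (t ^ 2) x) (dl s (1 / 3)) (dl s (-1 / 3))
  (fun x => Dd c (t ^ 2) x / (2 * Sf c (t ^ 2) x * sqrt (Sf c (t ^ 2) x ^ 3))));
  cbn [Rbar_lt]; try apply hd; try apply hd'; auto.
- intros x h1 h2; apply kap_derive_d, range_S; [split; assumption|lra].
- intros x h1 h2; assert (hx : in_range x) by (split; assumption).
  assert (hS : 0 < Sf c (t ^ 2) x) by (apply range_S; [exact hx|lra]).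
  apply Rdiv_lt_0_compat.
  + destruct (dl_between _ _ _ hx) as [z [hz ->]]; now apply Dd_pos.
  + apply Rmult_lt_0_compat; [lra|now apply sqrt_lt_R0, pow_lt].
Qed.

(** * The error at [t = 0] *)

Lemma e4_0 d : 0 < 3 - 2 * c * d ->
  e4 c 0 d = 1 - 2 * (3 - 4 * d ^ 2) / (c * (3 - 2 * c * d) ^ 2).
Proof.
intros hq; rewrite e4E by exact hc; unfold kap.
replace (Sf c (0 ^ 2) d ^ 3) with (((c * (3 - 2 * c * d)) ^ 3) ^ 2)
  by (unfold Sf, Af, Bf; ring).
rewrite sqrt_pow2 by (apply pow_le, Rmult_le_pos; lra).
unfold Nf; field; lra.
Qed.

(** From [2 c d > 3] one gets [(2 c d - 3) ^ 2 < 4 d ^ 2 - 9], so the curvature exceeds [2]; the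
    square root now yields [2 c d - 3] instead of its opposite. *)
Lemma e4_0_beyond_cusp d : 3 - 2 * c * d < 0 -> e4 c 0 d < - 1.
Proof.
intros hq; rewrite e4E by exact hc; unfold kap.
replace (Sf c (0 ^ 2) d ^ 3) with (((c * (2 * c * d - 3)) ^ 3) ^ 2)
  by (unfold Sf, Af, Bf; ring).
rewrite sqrt_pow2 by (apply pow_le, Rmult_le_pos; lra).
replace (Nf c (0 ^ 2) d / _) with (2 * (4 * d ^ 2 - 3) / (c * (2 * c * d - 3) ^ 2))
  by (unfold Nf; field; lra).
set (q := 2 * c * d - 3); assert (hq' : 0 < q) by (unfold q; lra).
assert (h : 2 < 2 * (4 * d ^ 2 - 3) / (c * q ^ 2)); [|lra].
assert (hcq : 0 < c * q ^ 2) by (apply Rmult_lt_0_compat; [lra|now apply pow_lt]).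
apply Rmult_lt_reg_r with (c * q ^ 2); [exact hcq|].
unfold Rdiv; rewrite Rmult_assoc, Rinv_l, Rmult_1_r by lra.
assert (hd : 0 < d) by nra.
assert (h1 : c * q ^ 2 <= q ^ 2) by (assert (0 <= q ^ 2) by apply pow2_ge_0; nra).
assert (h2 : q ^ 2 = 4 * c ^ 2 * d ^ 2 - 12 * (c * d) + 9) by (unfold q; ring).
assert (h3 : c ^ 2 * d ^ 2 <= d ^ 2).
{ assert (0 <= d ^ 2) by apply pow2_ge_0; assert (c ^ 2 <= 1) by nra; nra. }
unfold q in hq'; lra.
Qed.

Lemma e4_0_gap r d : 0 < 3 - 2 * c * d ->
  e4 c 0 d + r = gap0 s r d / (c * (3 - 2 * c * d) ^ 2).
Proof. intros hq; rewrite e4_0 by exact hq; unfold gap0; field; lra. Qed.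

Lemma cq_pos d : 0 < 3 - 2 * c * d -> 0 < c * (3 - 2 * c * d) ^ 2.
Proof. intros hq; apply Rmult_lt_0_compat; [lra|now apply pow_lt]. Qed.

Lemma e4_0_lt r d : 0 < 3 - 2 * c * d -> gap0 s r d < 0 -> e4 c 0 d < - r.
Proof.
intros hq h; assert (e := e4_0_gap r d hq).
assert (0 < - gap0 s r d / (c * (3 - 2 * c * d) ^ 2))
  by (apply Rdiv_lt_0_compat; [lra|now apply cq_pos]).
rewrite Rdiv_opp_l in *; lra.
Qed.

Lemma e4_0_gt r d : 0 < 3 - 2 * c * d -> 0 < gap0 s r d -> - r < e4 c 0 d.
Proof.
intros hq h; assert (e := e4_0_gap r d hq).
assert (0 < gap0 s r d / (c * (3 - 2 * c * d) ^ 2))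
  by (apply Rdiv_lt_0_compat; [lra|now apply cq_pos]).
lra.
Qed.

Lemma e4_0_incr d d' : c / 2 <= d -> d < d' -> 0 < 3 - 2 * c * d' -> e4 c 0 d < e4 c 0 d'.
Proof.
intros h1 h2 h3; assert (h4 : 0 < 3 - 2 * c * d) by nra.
rewrite !e4_0 by assumption.
assert (h : 2 * (3 - 4 * d' ^ 2) / (c * (3 - 2 * c * d') ^ 2)
            < 2 * (3 - 4 * d ^ 2) / (c * (3 - 2 * c * d) ^ 2)); [|lra].
apply Rlt_0_minus.
replace (_ - _) with
  (12 * ((d' - d) * ((2 * d - c) * (3 - 2 * c * d') + (2 * d' - c) * (3 - 2 * c * d)))
   / (c * (3 - 2 * c * d) ^ 2 * (3 - 2 * c * d') ^ 2)) by (field; lra).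
apply Rdiv_lt_0_compat.
- apply Rmult_lt_0_compat; [lra|]; apply Rmult_lt_0_compat; [lra|].
  apply Rplus_le_lt_0_compat; [apply Rmult_le_pos|apply Rmult_lt_0_compat]; lra.
- apply Rmult_lt_0_compat; [now apply cq_pos|now apply pow_lt].
Qed.

(** A quadratic in [d] with leading coefficient [4 c ^ 3 (1 + r) + 8 > 0] lies below its chords. *)
Lemma gap0_convex r a d b : 0 <= r -> a <= d <= b ->
  gap0 s r a < 0 -> gap0 s r b < 0 -> gap0 s r d < 0.
Proof.
intros hr hd ha hb; destruct (Req_dec a b) as [e|hne].
{ replace d with a by lra; exact ha. }
assert (E : (b - a) * gap0 s r d = (b - d) * gap0 s r a + (d - a) * gap0 s r b
  - (4 * c ^ 3 * (1 + r) + 8) * ((d - a) * (b - d) * (b - a)))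
  by (unfold gap0; ring).
assert (h1 : 0 <= (4 * c ^ 3 * (1 + r) + 8) * ((d - a) * (b - d) * (b - a))).
{ apply Rmult_le_pos.
  - assert (0 < c ^ 3) by (apply pow_lt; lra); nra.
  - repeat apply Rmult_le_pos; lra. }
assert (h2 : (b - d) * gap0 s r a + (d - a) * gap0 s r b < 0).
{ destruct (Req_dec d a) as [->|]; nra. }
apply Rmult_lt_reg_l with (b - a); lra.
Qed.

Lemma gap0_incr r a d : 0 <= r <= 1 -> c / 2 <= a <= d -> 0 < gap0 s (- r) a -> 0 < gap0 s (- r) d.
Proof.
intros hr ha h; apply Rlt_le_trans with (1 := h).
(* The secant slope is grouped into three nonnegative terms, using
   [c ^ 3 - 3 c + 2 = (1 - c) ^ 2 (c + 2)]. *)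
assert (E : gap0 s (- r) d - gap0 s (- r) a =
  (d - a) * ((8 + 4 * c ^ 3 * (1 - r)) * (d + a - c) + 4 * c * r * (3 * c - c ^ 3)
             + 4 * c * ((1 - c) ^ 2 * (c + 2))))
  by (unfold gap0; ring).
assert (0 < c ^ 3) by (apply pow_lt; lra).
assert (c ^ 3 <= 1 ^ 3) by (apply pow_incr; lra).
assert (c ^ 3 <= 3 * c) by nra.
assert (0 <= (8 + 4 * c ^ 3 * (1 - r)) * (d + a - c)) by (apply Rmult_le_pos; nra).
assert (0 <= 4 * c * r * (3 * c - c ^ 3))
  by (apply Rmult_le_pos; [apply Rmult_le_pos|]; lra).
assert (0 <= 4 * c * ((1 - c) ^ 2 * (c + 2))).
{ apply Rmult_le_pos; [lra|]; apply Rmult_le_pos; [apply pow2_ge_0|lra]. }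
apply Rminus_le; rewrite <- (Ropp_involutive (_ - _)), Ropp_minus_distr, E.
assert (0 <= (d - a) * ((8 + 4 * c ^ 3 * (1 - r)) * (d + a - c)
  + 4 * c * r * (3 * c - c ^ 3) + 4 * c * ((1 - c) ^ 2 * (c + 2))))
  by (apply Rmult_le_pos; lra).
lra.
Qed.

(** * Admissibility and the error of distant parameters *)

Lemma p'_second d t : snd (p' c d t) = sqrt (1 - c ^ 2) / 2 * Bf c (t ^ 2) d.
Proof. rewrite p'E by lra; reflexivity. Qed.

Lemma range_admissible d : in_range d -> admissible c d.
Proof.
intros hd t ht e; apply (f_equal snd) in e; rewrite p'_second in e; simpl snd in e.
destruct (range_facts d hd) as [h1 [h2 h3]].
assert (hB : 0 < Bf c (t ^ 2) d) by (apply Bf_pos; nra).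
assert (hr : 0 < sqrt (1 - c ^ 2)) by (apply sqrt_lt_R0; nra).
assert (0 < sqrt (1 - c ^ 2) / 2 * Bf c (t ^ 2) d) by (apply Rmult_lt_0_compat; lra).
lra.
Qed.

Lemma cusp_not_admissible d : 3 - 2 * c * d = 0 -> ~ admissible c d.
Proof.
intros hq h; apply (h 0); [lra|]; rewrite p'E by lra; f_equal; [ring|].
replace (2 + _) with (3 - 2 * c * d) by ring; rewrite hq; ring.
Qed.

(** The point [t = 0] is a witness except for [d < dL s]: when [c] is near [1] and [d] small, the
    curvature at [0] drops below [1], and [t ^ 2 = 4 / 5] takes over. *)
Lemma far_error d : 0 < d -> admissible c d -> ~ in_range d ->
  exists t, -1 <= t <= 1 /\ mu s <= Rabs (e4 c t d).
Proof.
intros hd had hout.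
assert (hm0 := mu_pos s hs); assert (hm1 := mu_lt1 s hs).
destruct (Rtotal_order (3 - 2 * c * d) 0) as [hq|[hq|hq]].
- exists 0; split; [lra|]; assert (h := e4_0_beyond_cusp d hq).
  rewrite Rabs_left; lra.
- now destruct (cusp_not_admissible d hq).
- destruct (Rlt_le_dec d (dL s)) as [hL|hL].
  + assert (h5 := sqrt_sqrt (4 / 5) ltac:(lra)); assert (h5' := sqrt_pos (4 / 5)).
    exists (sqrt (4 / 5)); split; [nra|].
    assert (h := kap_low s hs d (conj hd hL)); rewrite e4E by exact hc.
    rewrite pow2_sqrt by lra; rewrite Rabs_left; lra.
  + exists 0; split; [lra|].
    destruct (Rle_lt_dec d (dl s (1 / 3))) as [hA|hA].
    * assert (h : e4 c 0 d < - mu s).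
      { apply e4_0_lt; [exact hq|].
        apply (gap0_convex _ (dL s) d (dl s (1 / 3))); [lra|lra|now apply gap0_dL_neg|now apply gap0_dl_third_neg]. }
      rewrite Rabs_left; lra.
    * destruct (Rlt_le_dec d (dl s (-1 / 3))) as [hB|hB]; [now destruct hout|].
      assert (h : - - mu s < e4 c 0 d).
      { apply e4_0_gt; [exact hq|].
        apply gap0_incr with (dl s (-1 / 3)); [lra| |now apply gap0_dl_neg_third_pos].
        assert (h0 := dl_mid s hs 0 ltac:(lra)).
        assert (h1 := dl_decr (-1 / 3) 0 ltac:(lra)); lra. }
      rewrite Rabs_right; lra.
Qed.

Lemma optimal_criterion d M : in_range d -> is_max_error c d M -> M < mu s ->
  (forall d', in_range d' -> d' <> d -> exists t, -1 <= t <= 1 /\ M < Rabs (e4 c t d')) ->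
  is_optimal_parameter c d.
Proof.
intros hd hM hmu hcmp; split; [now apply range_facts|split; [now apply range_admissible|]].
exists M; split; [exact hM|]; intros d' M' hd' had hne [_ hM'].
destruct (Rlt_le_dec (dl s (1 / 3)) d') as [hA|hA];
  [destruct (Rlt_le_dec d' (dl s (-1 / 3))) as [hB|hB]|].
- destruct (hcmp d' (conj hA hB) hne) as [t [ht h]].
  specialize (hM' t ht); lra.
- destruct (far_error d' hd' had) as [t [ht h]]; [intros [_ h']; lra|].
  specialize (hM' t ht); lra.
- destruct (far_error d' hd' had) as [t [ht h]]; [intros [h' _]; lra|].
  specialize (hM' t ht); lra.
Qed.
End Arc.

(** * The optimal parameter *)

Lemma e4_1 c d : 0 < c < 1 -> 0 < d -> e4 c 1 d = 0.
Proof.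
intros hc hd; rewrite e4E by exact hc; unfold kap.
replace (Sf c (1 ^ 2) d ^ 3) with (((4 * (c * d)) ^ 3) ^ 2) by (unfold Sf, Af, Bf; ring).
assert (0 < c * d) by (apply Rmult_lt_0_compat; lra).
rewrite sqrt_pow2 by (apply pow_le; lra); unfold Nf; field; lra.
Qed.

Lemma e4_even c t d : 0 < c < 1 -> e4 c (- t) d = e4 c t d.
Proof. intros hc; rewrite !e4E by exact hc; now replace ((- t) ^ 2) with (t ^ 2) by ring. Qed.

Section Interval.
Variables (s : R) (tm tM : R -> R).
Hypothesis hs : 0 < s /\ 1 / 3 < s ^ 2 < 1 / 2.
Notation c := (cs s).
Hypothesis htm : forall d, in_I c d -> is_tm c d (tm d).
Hypothesis htM : forall d, in_I c d -> is_tM c d (tM d).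

Let hc : 0 < c < 1 := cs_range s hs.

Lemma in_I_dl d : in_I c d -> exists x, (9 - 10 * s) / 86 < x < 1 / 9 /\ d = dl s x.
Proof.
intros [h1 h2]; apply dl_between; [exact hs|].
assert (h3 := dl_9_lt_d1 s hs); assert (h4 := d2_lt_dl s hs); lra.
Qed.

Lemma in_I_range d : in_I c d -> in_range s d.
Proof.
intros hd; destruct (in_I_dl d hd) as [x [hx ->]]; assert (h := s_bounds s hs).
apply in_range_dl; [exact hs|lra].
Qed.

(** The bound [(9 - 10 * s) / 86] is positive, so [I_c] stays strictly below the zero [dl s 0]; its
    lower end lies above [dl s (1 / 9)]. *)
Lemma e4_0_neg d : in_I c d -> - mu s < e4 c 0 d < 0.
Proof.
intros hd; destruct (in_I_dl d hd) as [x [hx ->]]; assert (h := s_bounds s hs).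
assert (e : e4 c 0 (dl s 0) = 0).
{ assert (hq := dl_cusp s hs 0 ltac:(lra)).
  rewrite <- (Rplus_0_r (e4 c 0 _)), e4_0_gap by assumption.
  replace (gap0 s 0 (dl s 0)) with 0; [now rewrite Rdiv_0_l|].
  assert (hm := m_pos s hs); unfold gap0, cs, dl.
  set (m := (2 * s - 1) * _) in *; field_simplify_eq; [unfold m; ring|lra]. }
split.
- apply Rlt_trans with (e4 c 0 (dl s (1 / 9))).
  + apply e4_0_gt; [exact hs|apply dl_cusp; [exact hs|lra]|now apply gap0_dl_9_pos].
  + apply e4_0_incr; [exact hs|apply Rlt_le, dl_mid; [exact hs|lra]|
      apply dl_decr; [exact hs|lra]|apply dl_cusp; [exact hs|lra]].
- apply Rlt_le_trans with (e4 c 0 (dl s 0)); [|lra]; apply e4_0_incr; [exact hs|apply Rlt_le, dl_mid; [exact hs|lra]|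
      apply dl_decr; [exact hs|lra]|apply dl_cusp; [exact hs|lra]].
Qed.

(** [3 / 14] is slightly larger than [4 / 19], which places the local maximum where the error
    decreases with [d]. *)
Let t1 := sqrt (3 / 14).
Let t2 := sqrt (2 / 5).

Let ht1 : 0 < t1 /\ t1 ^ 2 = 3 / 14.
Proof. split; [apply sqrt_lt_R0|apply pow2_sqrt]; lra. Qed.

Let ht2 : 0 < t2 /\ t2 ^ 2 = 2 / 5.
Proof. split; [apply sqrt_lt_R0|apply pow2_sqrt]; lra. Qed.

Let ht : 0 < t1 < t2 /\ t2 < 1.
Proof. destruct ht1, ht2; repeat split; nra. Qed.

Let shape d (hd : in_I c d) :
  (t1 < tM d < t2 /\ forall t, t1 <= t <= t2 -> e4 c t d <= e4 c (tM d) d) /\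
  (t2 < tm d < 1 /\ forall t, t2 <= t <= 1 -> e4 c (tm d) d <= e4 c t d) /\
  (forall t, 0 <= t <= 1 -> e4 c t d <= e4 c (tM d) d \/ e4 c t d <= 0) /\
  (forall t, 0 <= t <= 1 -> e4 c 0 d <= e4 c t d \/ e4 c (tm d) d <= e4 c t d).
Proof.
assert (hr := in_I_range d hd); destruct (in_I_dl d hd) as [x [hx ex]].
assert (hb := s_bounds s hs); destruct ht1 as [p1 q1], ht2 as [p2 q2].
assert (D : forall t, 0 <= t <= 1 -> is_derive (fun y => e4 c y d) t
  (t * Du c (t ^ 2) d / (Sf c (t ^ 2) d * sqrt (Sf c (t ^ 2) d ^ 3)))).
{ intros t h; apply e4_derive_t; [exact hc|apply range_S; [exact hs|exact hr|nra]]. }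
assert (K : forall t, 0 <= t <= 1 -> 0 < Sf c (t ^ 2) d * sqrt (Sf c (t ^ 2) d ^ 3)).
{ intros t h; assert (0 < Sf c (t ^ 2) d) by (apply range_S; [exact hs|exact hr|nra]).
  apply Rmult_lt_0_compat; [|apply sqrt_lt_R0, pow_lt]; assumption. }
assert (L1 : 0 < t1 * Du c (t1 ^ 2) d / (Sf c (t1 ^ 2) d * sqrt (Sf c (t1 ^ 2) d ^ 3))).
{ apply Rdiv_lt_0_compat; [|apply K; lra]; apply Rmult_lt_0_compat; [exact p1|].
  rewrite q1, ex; apply Du_pos_3_14; [exact hs|lra]. }
assert (L2 : t2 * Du c (t2 ^ 2) d / (Sf c (t2 ^ 2) d * sqrt (Sf c (t2 ^ 2) d ^ 3)) < 0).
{ apply Ropp_lt_cancel; rewrite Ropp_0, <- Rdiv_opp_l, Ropp_mult_distr_r.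
  apply Rdiv_lt_0_compat; [|apply K; lra]; apply Rmult_lt_0_compat; [exact p2|].
  apply Ropp_0_gt_lt_contravar; rewrite q2, ex; apply Du_neg_2_5; [exact hs|lra]. }
assert (L3 : 0 < 1 * Du c (1 ^ 2) d / (Sf c (1 ^ 2) d * sqrt (Sf c (1 ^ 2) d ^ 3))).
{ apply Rdiv_lt_0_compat; [|apply K; lra]; apply Rmult_lt_0_compat; [lra|].
  rewrite pow1, ex; apply Du_pos_1; [exact hs|lra]. }
assert (F : forall t, 0 <= t <= 1 -> continuity_pt (fun y => e4 c y d) t)
  by (intros t h; now apply e4_continuity).
assert (E1 : e4 c 1 d = 0) by (apply e4_1; [exact hc|now apply (range_facts s hs)]).
assert (D1 := D t1 ltac:(lra)); assert (D2 := D t2 ltac:(lra)); assert (D3 := D 1 ltac:(lra)).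
split; [|split; [|split]].
- exact (shape_max (fun y => e4 c y d) _ _ _ _ _ ht F D1 L1 D2 L2 (htM d hd)).
- exact (shape_min (fun y => e4 c y d) _ _ _ _ _ ht F D2 L2 D3 L3 (htm d hd)).
- intros t h.
  assert (U := shape_upper (fun y => e4 c y d) _ _ _ _ _ _ _ ht F D1 L1 D2 L2 D3 L3 (htM d hd) (htm d hd) t h).
  cbv beta in U; now rewrite E1 in U.
- exact (shape_lower (fun y => e4 c y d) _ _ _ _ _ ht F D2 L2 D3 L3 (htm d hd)).
Qed.

Let tM_range d : in_I c d -> 0 <= tM d /\ 3 / 14 < tM d ^ 2 < 2 / 5 /\ tM d <= 1.
Proof.
intros hd; destruct (shape d hd) as [[h _] _], ht1, ht2; repeat split; nra.
Qed.

Let tm_range d : in_I c d -> 0 <= tm d /\ 2 / 5 < tm d ^ 2 < 1 /\ tm d <= 1.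
Proof.
intros hd; destruct (shape d hd) as [_ [[h _] _]], ht2; repeat split; nra.
Qed.

Let at_tM_decr d x y : in_I c d -> in_range s x -> in_range s y -> x < y ->
  e4 c (tM d) y < e4 c (tM d) x.
Proof. intros hd hx hy h; destruct (tM_range d hd); apply e4_decr; auto; lra. Qed.

Let at_tm_decr d x y : in_I c d -> in_range s x -> in_range s y -> x < y ->
  e4 c (tm d) y < e4 c (tm d) x.
Proof. intros hd hx hy h; destruct (tm_range d hd); apply e4_decr; auto; lra. Qed.

(** Only the maximizer of the larger parameter is followed back to [x], where the maximal value can
    only be larger. *)
Let max_decr x y : in_I c x -> in_I c y -> x < y -> e4 c (tM y) y < e4 c (tM x) x.
Proof.
intros hx hy h; destruct (shape x hx) as [[_ h1] _], (shape y hy) as [[h2 _] _].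
apply Rlt_le_trans with (e4 c (tM y) x); [|apply h1; lra].
apply at_tM_decr; auto using in_I_range.
Qed.

Let min_decr x y : in_I c x -> in_I c y -> x < y -> e4 c (tm y) y < e4 c (tm x) x.
Proof.
intros hx hy h; destruct (shape y hy) as [_ [[_ h1] _]], (shape x hx) as [_ [[h2 _] _]].
apply Rle_lt_trans with (e4 c (tm x) y); [apply h1; lra|].
apply at_tm_decr; auto using in_I_range.
Qed.

Let error_le d M : in_I c d -> 0 <= M -> e4 c (tM d) d <= M ->
  - M <= e4 c 0 d -> - M <= e4 c (tm d) d ->
  forall t, -1 <= t <= 1 -> Rabs (e4 c t d) <= M.
Proof.
intros hd hM h1 h2 h3.
assert (H : forall t, 0 <= t <= 1 -> Rabs (e4 c t d) <= M).
{ intros t htt; destruct (shape d hd) as [_ [_ [hu hl]]].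
  apply Rabs_le; split; [destruct (hl t htt)|destruct (hu t htt)]; lra. }
intros t htt; destruct (Rle_lt_dec 0 t); [apply H; lra|].
rewrite <- e4_even by exact hc; apply H; lra.
Qed.

Let max_lt_mu d : in_I c d -> e4 c (tM d) d < mu s.
Proof.
intros hd; assert (h9 := dl_9_lt_d1 s hs); destruct (tM_range d hd) as [h1 [h2 h3]].
apply Rlt_trans with (e4 c (tM d) (dl s (1 / 9))).
- apply at_tM_decr; [exact hd|apply in_range_dl; [exact hs|lra]|now apply in_I_range|].
  destruct hd; lra.
- rewrite e4E by exact hc.
  assert (h := kap_dl_9 s hs (tM d ^ 2) ltac:(lra)); lra.
Qed.

(** Monotonicity carries the bounds [beta s] and [- beta s] from [dl s (1 / 23)] to larger
    parameters. *)
Let unbalanced_right d : in_I c d -> dl s (1 / 23) <= d -> e4 c (tM d) d + e4 c (tm d) d < 0.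
Proof.
intros hd h; destruct (tM_range d hd) as [a1 [a2 a3]].
assert (hr : in_range s (dl s (1 / 23))) by (apply in_range_dl; [exact hs|lra]).
assert (q1 : sqrt (4 / 5) ^ 2 = 4 / 5) by (apply pow2_sqrt; lra).
assert (q2 := sqrt_pos (4 / 5)).
assert (A : forall t, 0 <= t -> 4 / 19 < t ^ 2 < 1 -> e4 c t d <= e4 c t (dl s (1 / 23))).
{ intros t h1 h2; destruct (Req_dec (dl s (1 / 23)) d) as [<-|]; [lra|].
  apply Rlt_le, e4_decr; auto using in_I_range; lra. }
assert (B : e4 c (tm d) d <= e4 c (sqrt (4 / 5)) d).
{ destruct (shape d hd) as [_ [[_ hl] _]], ht2; apply hl; nra. }
assert (B1 := A (sqrt (4 / 5)) q2 ltac:(lra)); assert (A1 := A (tM d) a1 ltac:(lra)).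
rewrite (e4E c (sqrt (4 / 5)) (dl s _)), q1 in B1 by exact hc.
rewrite (e4E c (tM d) (dl s _)) in A1 by exact hc.
assert (K1 := kap_dl_23 s hs (tM d ^ 2) ltac:(lra)); assert (K2 := kap_dl_23_4_5 s hs).
lra.
Qed.

Let competitor_min d x : in_I c d -> in_range s x -> d < x -> e4 c (tm d) d < 0 ->
  exists t, -1 <= t <= 1 /\ - e4 c (tm d) d < Rabs (e4 c t x).
Proof.
intros hd hx h h0; destruct (tm_range d hd) as [a1 [a2 a3]]; exists (tm d); split; [lra|].
assert (h1 := at_tm_decr d d x hd (in_I_range d hd) hx h).
rewrite Rabs_left; lra.
Qed.

Variable de : R.
Hypothesis hde : in_I c de /\ e4 c 0 de = e4 c (tm de) de.

Lemma optimal_at_de : e4 c (tM de) de <= Rabs (e4 c 0 de) -> is_optimal_parameter c de.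
Proof.
destruct hde as [hd e]; assert (h0 := e4_0_neg de hd); rewrite Rabs_left by lra; intros hM.
apply (optimal_criterion s hs) with (- e4 c 0 de); [now apply in_I_range| |lra|].
- split; [exists 0; split; [|apply Rabs_left]; lra|].
  apply error_le; auto; lra.
- intros x hx hne; destruct (Rtotal_order x de) as [h|[h|h]]; [|contradiction|].
  + exists 0; split; [lra|].
    destruct (range_facts s hs x hx) as [_ [h1 _]].
    destruct (range_facts s hs de (in_I_range de hd)) as [_ [_ h2]].
    assert (h3 := e4_0_incr s hs x de ltac:(lra) h h2); rewrite Rabs_left; lra.
  + rewrite e; apply competitor_min; auto; lra.
Qed.

Lemma optimal_right_of_de : e4 c (tM de) de > Rabs (e4 c 0 de) ->
  exists d, unique (fun x => in_I c x /\ x > de /\ e4 c (tM x) x = Rabs (e4 c (tm x) x)) d /\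
            is_optimal_parameter c d.
Proof.
destruct hde as [hd e]; assert (h0 := e4_0_neg de hd); rewrite Rabs_left by lra; intros hM.
assert (hle : de < dl s (1 / 23)).
{ destruct (Rlt_le_dec de (dl s (1 / 23))) as [|h]; [assumption|].
  assert (h' := unbalanced_right de hd h); lra. }
assert (h23 := dl_23_lt_d2 s hs).
assert (hI : forall d, de <= d <= dl s (1 / 23) -> in_I c d)
  by (intros d h; destruct hd; split; lra).
assert (hneg : forall d, in_I c d -> d > de -> e4 c (tm d) d < 0)
  by (intros d h1 h2; assert (h := min_decr de d hd h1 h2); lra).
(* The sum of the two extremal values is positive at [de], by the case hypothesis and the equality
   of the minimum with the value at [0], and negative at [dl s (1 / 23)], which still lies in
   [I_c]. *)
destruct (balanced_parameter (e4 c) tM tm de (dl s (1 / 23)) t1 t2 1) as [d [hd1 hd2]].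
- exact hle.
- lra.
- intros d h; destruct (shape d (hI d h)) as [[h1 h2] _]; split; [lra|exact h2].
- intros d h; destruct (shape d (hI d h)) as [_ [[h1 h2] _]]; split; [lra|exact h2].
- intros t d h1 h2; apply e4_continuity_2d; [exact hs|now apply in_I_range, hI|lra].
- lra.
- apply unbalanced_right; [apply hI|]; lra.
- assert (hdI := hI d ltac:(lra)); assert (hn := hneg d hdI ltac:(lra)).
  exists d; split; [split|].
  + split; [exact hdI|split; [lra|rewrite Rabs_left; lra]].
  + intros x [hx1 [hx2 hx3]]; assert (hx := hneg x hx1 hx2).
    rewrite Rabs_left in hx3 by exact hx.
    (* Both extremal values strictly decrease, so their sum vanishes only once. *)
    destruct (Rtotal_order d x) as [h|[h|h]]; [|exact h|].
    * assert (a1 := max_decr d x hdI hx1 h); assert (a2 := min_decr d x hdI hx1 h); lra.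
    * assert (a1 := max_decr x d hx1 hdI h); assert (a2 := min_decr x d hx1 hdI h); lra.
  + assert (hr := in_I_range d hdI); assert (hm := max_lt_mu d hdI).
    destruct (tm_range d hdI) as [b1 [b2 b3]], (tM_range d hdI) as [a1 [a2 a3]].
    apply (optimal_criterion s hs) with (- e4 c (tm d) d); [exact hr| |lra|].
    * split; [exists (tm d); split; [|apply Rabs_left]; lra|].
      apply error_le; auto; try lra.
      (* From [de], where they agree, the value at [0] increases and the minimum decreases, so [0]
         is no worse than [tm d]. *)
      destruct (range_facts s hs de (in_I_range de hd)) as [_ [h1 _]].
      destruct (range_facts s hs d hr) as [_ [_ h2]].
      assert (h3 := e4_0_incr s hs de d ltac:(lra) ltac:(lra) h2).
      assert (h4 := min_decr de d hd hdI ltac:(lra)); lra.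
    * intros x hx hne; destruct (Rtotal_order x d) as [h|[h|h]]; [|contradiction|].
      -- exists (tM d); split; [lra|]; assert (h1 := at_tM_decr d x d hdI hx hr h).
         rewrite Rabs_right; lra.
      -- now apply competitor_min.
Qed.
End Interval.

Lemma cs_surj c : 0 < c < 1 -> exists s, (0 < s /\ 1 / 3 < s ^ 2 < 1 / 2) /\ cs s = c.
Proof.
intros hc; exists (sqrt ((c + 2) / 6)).
assert (h : sqrt ((c + 2) / 6) ^ 2 = (c + 2) / 6) by (apply pow2_sqrt; lra).
unfold cs; rewrite h; repeat split; [apply sqrt_lt_R0| | |]; lra.
Qed.

Theorem theorem5p4 (c : R) (tm tM : R -> R) (de : R)
    (hc : 0 < c < 1)
    (htm : forall d, in_I c d -> is_tm c d (tm d))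
    (htM : forall d, in_I c d -> is_tM c d (tM d))
    (hde : is_de c tm de) :
  (e4 c (tM de) de <= Rabs (e4 c 0 de) -> is_optimal_parameter c de) /\
  (e4 c (tM de) de > Rabs (e4 c 0 de) ->
   exists d,
     unique (fun x => in_I c x /\ x > de /\
                      e4 c (tM x) x = Rabs (e4 c (tm x) x)) d /\
     is_optimal_parameter c d).
Proof.
destruct (cs_surj c hc) as [s [hs <-]]; destruct hde as [hde _]; split.
- now apply optimal_at_de with tm.
- now apply optimal_right_of_de.
Qed.
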